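(* Let $R$ be a ring. The following statements are equivalent: (a) $R$ is a QF ring. (b) $R$ is one-sided Noetherian, right dual Kasch and $E(R)$ is projective. (c) $R$ is one-sided Noetherian, right dual Kasch, semilocal and $E(R)$ is max-projective. If moreover $R$ is commutative, then the following condition is also equivalent to (a), (b) and (c): (d) $R$ is perfect and $E(R)$ is max-projective.
   Context: Rings are associative, unital and non-trivial; modules are unital right modules. $E(R)$ is the injective hull of $R$ as a right $R$-module. One-sided Noetherian means left Noetherian or right Noetherian. A ring is quasi-Frobenius (QF) if it is one-sided Noetherian and one-sided self-injective (equivalently, two-sided Artinian and two-sided self-injective). A ring $R$ is right dual Kasch if every simple right $R$-module is isomorphic to a factor module of an injective right $R$-module. $R$ is semilocal if $R/\mathrm{Jac}(R)$ is semisimple Artinian. A right $R$-module $M$ is max-projective if for every maximal right ideal $I$ of $R$, every homomorphism $M\to R/I$ factors through the canonical epimorphism $R\to R/I$. *)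

(* Defs.v *)
From HB Require Import structures.
From mathcomp Require Import all_boot all_algebra.
From mathcomp Require Import generic_quotient ring_quotient boolp.

Set Implicit Arguments.
Unset Strict Implicit.
Unset Printing Implicit Defensive.

Import GRing.Theory.

Local Open Scope ring_scope.
Local Open Scope quotient_scope.

(* Unital right modules over R are the unital left modules over the converse
   ring R^c, so module notions are stated once, for left modules over an
   arbitrary ring A, and used with A := R or A := R^c.  The regular modules
   are R^o (left) and R^c^o (right).

   Submodules are the library's boolean closed predicates [submodClosed M], and
   carriers are choiceTypes; given the axioms of boolp, neither is a restriction.

   The ring structure is pzRingType only so that R/Jac(R) can be formed without
   first proving, by Zorn's lemma, that it is nontrivial. *)
Notation rmodType R := (lmodType R^c).

Section Quotient.
Variables (A : pzRingType) (M : lmodType A) (N : submodClosed M).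

Definition submod_pred : {pred M} := fun x => x \in N.

Lemma submod_pred_closed : zmod_closed submod_pred.
Proof. exact: (GRing.submod_closedB (submodClosedP N)). Qed.

HB.instance Definition _ := GRing.isZmodClosed.Build M submod_pred
  submod_pred_closed.

Definition quotm : Type := {ideal_quot submod_pred}.

HB.instance Definition _ := GRing.Zmodule.on quotm.

Definition quotm_pi (x : M) : quotm := \pi_{ideal_quot submod_pred} x.

Definition quotm_scale (a : A) (u : quotm) : quotm :=
  quotm_pi (a *: repr (u : {ideal_quot submod_pred})).

Lemma quotm_piE x y : (quotm_pi x == quotm_pi y) = (x - y \in N).
Proof. by rewrite [LHS]piE Quotient.equivE. Qed.

Lemma quotm_pi_surj u : exists x, quotm_pi x = u.
Proof. by exists (repr (u : {ideal_quot submod_pred})); apply: reprK. Qed.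

Lemma quotm_piD : {morph quotm_pi : x y / x + y}.
Proof. by move=> x y; rewrite /quotm_pi piE. Qed.

Lemma quotm_piZ a x : quotm_pi (a *: x) = quotm_scale a (quotm_pi x).
Proof.
apply/eqP; rewrite quotm_piE -scalerBr.
apply: rpredZ; rewrite -quotm_piE; apply/eqP.
by rewrite /quotm_pi reprK.
Qed.

Lemma quotm_scaleA a b u :
  quotm_scale a (quotm_scale b u) = quotm_scale (a * b) u.
Proof. by case: (quotm_pi_surj u) => x <-; rewrite -!quotm_piZ scalerA. Qed.

Lemma quotm_scale1 : left_id 1 quotm_scale.
Proof. by move=> u; case: (quotm_pi_surj u) => x <-; rewrite -quotm_piZ scale1r. Qed.

Lemma quotm_scaleDr : right_distributive quotm_scale +%R.
Proof.
move=> a u v; case: (quotm_pi_surj u) (quotm_pi_surj v) => x <- [y <-].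
by rewrite -quotm_piD -!quotm_piZ scalerDr quotm_piD.
Qed.

Lemma quotm_scaleDl u : {morph quotm_scale^~ u : a b / a + b}.
Proof.
move=> a b; case: (quotm_pi_surj u) => x <-.
by rewrite -!quotm_piZ scalerDl quotm_piD.
Qed.

HB.instance Definition _ := GRing.Zmodule_isLmodule.Build A quotm
  quotm_scaleA quotm_scale1 quotm_scaleDr quotm_scaleDl.

Lemma quotm_pi_linear : linear quotm_pi.
Proof. by move=> a x y; rewrite quotm_piD quotm_piZ. Qed.

HB.instance Definition _ := GRing.isLinear.Build A M quotm *:%R quotm_pi
  quotm_pi_linear.

End Quotient.

Section Modules.
Variable A : pzRingType.
Implicit Types M P E S : lmodType A.

Definition isomorphic M1 M2 : Prop := exists f : {linear M1 -> M2}, bijective f.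

Definition maximal_submod M (N : submodClosed M) : Prop :=
  (exists x, x \notin N) /\
  forall N' : submodClosed M, {subset N <= N'} ->
    N' =i N \/ (forall x, x \in N').

Definition simple_module S : Prop :=
  (exists x : S, x != 0) /\
  forall N : submodClosed S,
    (forall x, x \in N -> x = 0) \/ (forall x, x \in N).

Definition semisimple_module M : Prop :=
  forall N : submodClosed M, exists N' : submodClosed M,
    (forall x, x \in N -> x \in N' -> x = 0) /\
    (forall x, exists y z, [/\ y \in N, z \in N' & x = y + z]).

Definition noetherian_module M : Prop :=
  forall N : nat -> submodClosed M,
    (forall n, {subset N n <= N n.+1}) ->
    exists n, forall m, (n <= m)%N -> N m =i N n.

Definition artinian_module M : Prop :=
  forall N : nat -> submodClosed M,
    (forall n, {subset N n.+1 <= N n}) ->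
    exists n, forall m, (n <= m)%N -> N m =i N n.

Definition injective_module E : Prop :=
  forall (M1 M2 : lmodType A) (i : {linear M1 -> M2}) (f : {linear M1 -> E}),
    injective i -> exists g : {linear M2 -> E}, forall x, g (i x) = f x.

Definition surjective_map (T1 T2 : Type) (f : T1 -> T2) : Prop :=
  forall y, exists x, f x = y.

Definition projective_module P : Prop :=
  forall (M1 M2 : lmodType A) (p : {linear M1 -> M2}) (f : {linear P -> M2}),
    surjective_map p -> exists g : {linear P -> M1}, forall x, p (g x) = f x.

Definition max_projective_module M : Prop :=
  forall I : submodClosed A^o, maximal_submod I ->
  forall f : {linear M -> quotm I},
    exists g : {linear M -> A^o}, forall x, f x = quotm_pi I (g x).

Definition injective_hull M E (i : {linear M -> E}) : Prop :=
  [/\ injective_module E, injective i &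
      forall N : submodClosed E, (exists2 y, y \in N & y != 0) ->
        exists2 x : M, i x \in N & i x != 0].

(* "E(M) satisfies P", for an isomorphism-invariant P: E(M) is determined only up
   to isomorphism. *)
Definition injective_hull_satisfies M (P : lmodType A -> Prop) : Prop :=
  exists (E : lmodType A) (i : {linear M -> E}), injective_hull i /\ P E.

Definition superfluous M (N : {pred M}) : Prop :=
  forall K : submodClosed M,
    (forall x, exists y z, [/\ y \in K, z \in N & x = y + z]) ->
    forall x, x \in K.

Definition projective_cover M P (p : {linear P -> M}) : Prop :=
  [/\ projective_module P, surjective_map p & superfluous [pred x | p x == 0]].

End Modules.

Section Jacobson.
Variable R : pzRingType.

(* Jac(R) as the intersection of the maximal right ideals. *)
Definition jacobson : {pred R} := fun x : R =>
  `[< forall I : submodClosed R^c^o, maximal_submod I -> (x : R^c^o) \in I >].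

Lemma jacobsonP (x : R) :
  reflect (forall I : submodClosed R^c^o, maximal_submod I -> (x : R^c^o) \in I)
    (x \in jacobson).
Proof. exact: asboolP. Qed.

Lemma jacobson_zmod_closed : zmod_closed jacobson.
Proof.
split=> [|x y /jacobsonP Jx /jacobsonP Jy]; apply/jacobsonP=> I mI.
  exact: (submodClosedP I).1.
apply: (GRing.submod_closedB (submodClosedP I)).2; [exact: Jx|exact: Jy].
Qed.

HB.instance Definition _ := GRing.isZmodClosed.Build R jacobson
  jacobson_zmod_closed.

Lemma jacobsonMr (a x : R) : x \in jacobson -> x * a \in jacobson.
Proof.
move=> /jacobsonP Jx; apply/jacobsonP=> I mI.
exact: (@rpredZ _ _ I (a : R^c) _ (Jx I mI)).
Qed.

Section Colon.
Variables (r : R) (I : submodClosed R^c^o).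

Definition colon : {pred R^c^o} := fun y : R^c^o => ((r * (y : R) : R) : R^c^o) \in I.

Lemma colon_closed : subsemimod_closed colon.
Proof.
split; first split.
- by rewrite unfold_in /colon mulr0; apply: (submodClosedP I).1.
- move=> x y Ix Iy; rewrite unfold_in /colon mulrDr; exact: rpredD.
- move=> a x Ix; rewrite unfold_in /colon.
  have -> : r * (a *: x : R^c^o) = a *: (r * (x : R) : R^c^o) :> R^c^o.
    exact: (@mulrA R r x a).
  exact: rpredZ.
Qed.

HB.instance Definition _ := GRing.isSubmodClosed.Build R^c R^c^o colon
  colon_closed.

End Colon.

Lemma colon_maximal (r : R) (I : submodClosed R^c^o) :
  maximal_submod I -> (r : R^c^o) \notin I -> maximal_submod (colon r I).
Proof.
move=> [_ mI] rI; split; first by exists 1; rewrite unfold_in /colon mulr1.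
move=> K sIK.
have [[y yK yI]|noy] := pselect (exists2 y, y \in K & y \notin (colon r I)); last first.
  left=> x; apply/idP/idP; last exact: sIK.
  by move=> xK; apply: contra_notT noy => xI; exists x.
right.
pose L : {pred R^c^o} := fun z : R^c^o =>
  `[< exists i k, [/\ i \in I, k \in K & z = i + (r * (k : R) : R)] >].
have Lcl : subsemimod_closed L.
  split; first split.
  - apply/asboolP; exists 0, 0; split; [exact: rpred0|exact: rpred0|].
    by rewrite mulr0 addr0.
  - move=> _ _ /asboolP[i [k [Ii Kk ->]]] /asboolP[j [l [Ij Kl ->]]].
    apply/asboolP; exists (i + j), (k + l); split; [exact: rpredD|exact: rpredD|].
    by rewrite (@mulrDr R) addrACA.
  - move=> a _ /asboolP[i [k [Ii Kk ->]]]; apply/asboolP.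
    exists (a *: i), (a *: k); split; [exact: rpredZ|exact: rpredZ|].
    rewrite scalerDr; congr (_ + _); exact: esym (@mulrA R r k a).
pose Lm := HB.pack_for (submodClosed R^c^o) L
  (GRing.isSubmodClosed.Build R^c R^c^o L Lcl).
have sIL : {subset I <= Lm}.
  move=> i Ii; apply/asboolP; exists i, 0; split=> //; first exact: rpred0.
  by rewrite mulr0 addr0.
have [eqLI|Lall] := mI Lm sIL.
  case/negP: yI; rewrite unfold_in /colon -eqLI; apply/asboolP.
  by exists 0, y; split=> //; [exact: rpred0|rewrite add0r].
move=> x; have /asboolP[i [k [Ii Kk rxE]]] := Lall (r * (x : R) : R).
have xkK : x - k \in K.
  apply: sIK; rewrite unfold_in /colon (@mulrBr R).
  by rewrite [r * x]rxE addrK.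
by rewrite -(subrK k x); apply: rpredD.
Qed.

Lemma jacobsonMl (a x : R) : x \in jacobson -> a * x \in jacobson.
Proof.
move=> /jacobsonP Jx; apply/jacobsonP=> I mI.
have [aI|aI] := boolP ((a : R^c^o) \in I).
  exact: (@rpredZ _ _ I (x : R^c) _ aI).
exact: Jx _ (colon_maximal mI aI).
Qed.

Definition quot_jacobson : Type := {ideal_quot jacobson}.

HB.instance Definition _ := GRing.Zmodule.on quot_jacobson.

Definition qjac_pi (x : R) : quot_jacobson := \pi_{ideal_quot jacobson} x.

Definition qjac_one : quot_jacobson := qjac_pi 1.
Definition qjac_mul (u v : quot_jacobson) : quot_jacobson :=
  qjac_pi (repr (u : {ideal_quot jacobson}) * repr (v : {ideal_quot jacobson})).

Lemma qjac_piE x y : (qjac_pi x == qjac_pi y) = (x - y \in jacobson).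
Proof. by rewrite [LHS]piE Quotient.equivE. Qed.

Lemma qjac_pi_surj u : exists x, qjac_pi x = u.
Proof. by exists (repr (u : {ideal_quot jacobson})); apply: reprK. Qed.

Lemma qjac_piD : {morph qjac_pi : x y / x + y}.
Proof. by move=> x y; rewrite /qjac_pi piE. Qed.

Lemma qjac_piM x y : qjac_pi (x * y) = qjac_mul (qjac_pi x) (qjac_pi y).
Proof.
apply/eqP; rewrite qjac_piE.
set x' := repr _; set y' := repr _.
have Jx : x - x' \in jacobson by rewrite -qjac_piE /x' /qjac_pi reprK.
have Jy : y - y' \in jacobson by rewrite -qjac_piE /y' /qjac_pi reprK.
have -> : x * y - x' * y' = (x - x') * y + x' * (y - y').
  by rewrite mulrBl mulrBr addrA subrK.
by apply: rpredD; [exact: jacobsonMr|exact: jacobsonMl].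
Qed.

Lemma qjac_mulA : associative qjac_mul.
Proof.
move=> u v w.
case: (qjac_pi_surj u) (qjac_pi_surj v) (qjac_pi_surj w) => x <- [y <-] [z <-].
by rewrite -!qjac_piM mulrA.
Qed.

Lemma qjac_mul1 : left_id qjac_one qjac_mul.
Proof. by move=> u; case: (qjac_pi_surj u) => x <-; rewrite -qjac_piM mul1r. Qed.

Lemma qjac_1mul : right_id qjac_one qjac_mul.
Proof. by move=> u; case: (qjac_pi_surj u) => x <-; rewrite -qjac_piM mulr1. Qed.

Lemma qjac_mulDl : left_distributive qjac_mul +%R.
Proof.
move=> u v w.
case: (qjac_pi_surj u) (qjac_pi_surj v) (qjac_pi_surj w) => x <- [y <-] [z <-].
by rewrite -qjac_piD -!qjac_piM mulrDl qjac_piD.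
Qed.

Lemma qjac_mulDr : right_distributive qjac_mul +%R.
Proof.
move=> u v w.
case: (qjac_pi_surj u) (qjac_pi_surj v) (qjac_pi_surj w) => x <- [y <-] [z <-].
by rewrite -qjac_piD -!qjac_piM mulrDr qjac_piD.
Qed.

HB.instance Definition _ := GRing.Zmodule_isPzRing.Build quot_jacobson
  qjac_mulA qjac_mul1 qjac_1mul qjac_mulDl qjac_mulDr.

Lemma qjac_pi_zmod_morphism : zmod_morphism qjac_pi.
Proof. by move=> x y; rewrite /qjac_pi !piE. Qed.

Lemma qjac_pi_monoid_morphism : monoid_morphism qjac_pi.
Proof. by split=> // x y; rewrite qjac_piM. Qed.

HB.instance Definition _ := GRing.isZmodMorphism.Build R quot_jacobson qjac_pi
  qjac_pi_zmod_morphism.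
HB.instance Definition _ := GRing.isMonoidMorphism.Build R quot_jacobson qjac_pi
  qjac_pi_monoid_morphism.

End Jacobson.

Section Rings.
Variable R : pzRingType.

Definition left_noetherian : Prop := noetherian_module R^o.
Definition right_noetherian : Prop := noetherian_module R^c^o.
Definition one_sided_noetherian : Prop := left_noetherian \/ right_noetherian.

Definition left_self_injective : Prop := injective_module R^o.
Definition right_self_injective : Prop := injective_module R^c^o.
Definition one_sided_self_injective : Prop :=
  left_self_injective \/ right_self_injective.

Definition quasi_frobenius : Prop :=
  one_sided_noetherian /\ one_sided_self_injective.

Definition right_dual_kasch : Prop :=
  forall S : rmodType R, simple_module S ->
    exists (E : rmodType R) (N : submodClosed E),
      injective_module E /\ isomorphic S (quotm N).

Definition semisimple_artinian : Prop :=
  semisimple_module R^c^o /\ artinian_module R^c^o.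

Definition left_perfect : Prop :=
  forall M : lmodType R,
    exists (P : lmodType R) (p : {linear P -> M}), projective_cover p.

Definition right_perfect : Prop :=
  forall M : rmodType R,
    exists (P : rmodType R) (p : {linear P -> M}), projective_cover p.

(* Bass's definition: every module, on either side, has a projective cover. *)
Definition perfect_ring : Prop := left_perfect /\ right_perfect.

(* E(R), the injective hull of R as a right R-module. *)
Definition ER_projective : Prop :=
  injective_hull_satisfies R^c^o (@projective_module R^c).

Definition ER_max_projective : Prop :=
  injective_hull_satisfies R^c^o (@max_projective_module R^c).

End Rings.

Definition semilocal (R : pzRingType) : Prop :=
  semisimple_artinian (quot_jacobson R).

(* Main.v *)
From HB Require Import structures.
Require Import Defs.
From mathcomp Require Import all_boot all_algebra.
From mathcomp Require Import generic_quotient ring_quotient boolp.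
From mathcomp Require classical_sets.
From mathcomp Require Import freeg.

(** Conditions (b) and (c) both make E(R) max-projective, and imply (a) through
   max_projective_lself_inj. A simple right module R/I is a factor of an injective
   module, and therefore of E(R), because maps from R to an injective module extend to
   E(R). By max-projectivity E(R) -> R/I lifts to a map E(R) -> R whose image is not
   inside I. Hence the trace of E(R) in R lies in no maximal right ideal, so it is R:
   there are maps g_i and elements e_i with 1 = sum g_i(e_i). This makes R a direct
   factor of a power of E(R), that is, right self-injective; together with the assumed
   chain condition R is quasi-Frobenius.

   Conversely, once R is right self-injective, E(R) = R is projective and every simple
   right module is a factor of the injective module R. The point is thus the symmetry
   of quasi-Frobenius rings (quasi_frobenius_lacc_rself_inj): the chain condition and
   self-injectivity may be given on different sides. Let R be right self-injective
   with a one-sided chain condition, and J its radical. Then J is the right singular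
   ideal and R/J is von Neumann regular, hence semisimple. Left ideals obtained from
   annihilators by adjoining an element are again annihilators; with the chain
   condition this makes J nilpotent (acc_loewy) and carries the chain condition over
   to left ideals (one_sided_lacc), so all left ideals are annihilators. Each maximal
   ideal T kills a minimal right ideal, and the annihilator of the latter is a maximal
   ideal T'. The assignment T -> T' is injective because isomorphisms between minimal
   right ideals are left multiplications, and it is onto because there are finitely
   many maximal ideals. So every simple right module embeds in R (rself_inj_kasch),
   all right ideals are annihilators as well, and R is left self-injective
   (rself_inj_lself_inj); the same applies to the converse ring. Semilocality is the
   semisimplicity of R/J.

   For the commutative case, a quasi-Frobenius ring is semiprimary: if F is free and
   maps onto M with kernel K, the projection of the semisimple module F/JF onto a
   complement of the image of K lifts to an idempotent endomorphism e of F, and eF is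
   a projective cover of M (semiprimary_projective_cover).

   Now let R be commutative and perfect with E(R) max-projective. Projective covers of
   the modules R/m provide local idempotents e with em inside J, and M = JM forces
   M = 0 by Bass's argument, so that J is T-nilpotent. It follows that E(R) maps onto
   every R/m, hence R is self-injective as above, and that every R/m embeds in R, so
   ideals are annihilators. A self-injective ring in which ideals are annihilators is
   linearly compact: some c is congruent to x_0 + ... + x_(n-1) modulo the n-th tail
   for all n (tail_limit). If an ideal I were not finitely generated, the semisimple
   module I/JI would contain an infinite independent sequence, and the limit of its
   partial sums would be a finite combination with infinitely many coordinates 1. So R
   is Noetherian (perfect_lideal_spans). *)

Set Implicit Arguments.
Unset Strict Implicit.
Unset Printing Implicit Defensive.

Import GRing.Theory.

Local Open Scope ring_scope.

(** * Submodules and Zorn's lemma *)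

Lemma dependent_choice (X : Type) (x0 : X) (S : X -> X -> Prop) :
  (forall x, exists y, S x y) ->
  exists2 f : nat -> X, f 0%N = x0 & forall n, S (f n) (f n.+1).
Proof.
move=> /choice[g gP]; exists (fun n => iter n g x0) => // n.
Qed.

Section Submodules.
Variables (A : pzRingType) (M : lmodType A).
Implicit Types (N K P : M -> Prop) (x y : M) (a : A).

Definition submodule P : Prop :=
  [/\ P 0, forall x y, P x -> P y -> P (x + y) & forall a x, P x -> P (a *: x)].

Lemma submod0 P : submodule P -> P 0. Proof. by case. Qed.
Lemma submodD P x y : submodule P -> P x -> P y -> P (x + y).
Proof. by case=> _ + _; apply. Qed.
Lemma submodZ P a x : submodule P -> P x -> P (a *: x).
Proof. by case=> _ _; apply. Qed.
Lemma submodN P x : submodule P -> P x -> P (- x).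
Proof. by move=> sP Px; rewrite -scaleN1r; apply: submodZ. Qed.
Lemma submodB P x y : submodule P -> P x -> P y -> P (x - y).
Proof. by move=> sP Px Py; apply: submodD => //; apply: submodN. Qed.
Lemma submod_sum P I (r : seq I) (F : I -> M) :
  submodule P -> (forall i, P (F i)) -> P (\sum_(i <- r) F i).
Proof.
move=> sP PF; elim: r => [|i r IHr]; first by rewrite big_nil; apply: submod0.
by rewrite big_cons; apply: submodD.
Qed.

Lemma submod_zero : submodule (fun x => x = 0).
Proof.
by split=> [|x y -> ->|a x ->] //; rewrite ?addr0 ?scaler0.
Qed.

Lemma submod_in (N : submodClosed M) : submodule (fun x => x \in N).
Proof. by split=> *; [apply: rpred0|apply: rpredD|apply: rpredZ]. Qed.

Lemma submod_closed_of P : submodule P ->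
  exists N : submodClosed M, forall x, (x \in N) = `[< P x >].
Proof.
move=> sP; pose L : {pred M} := fun x => `[< P x >].
have Lcl : subsemimod_closed L.
  split; first split.
  - exact/asboolP/(submod0 sP).
  - by move=> x y /asboolP Px /asboolP Py; apply/asboolP; apply: submodD.
  - by move=> a x /asboolP Px; apply/asboolP; apply: submodZ.
pose N := HB.pack_for (submodClosed M) L (GRing.isSubmodClosed.Build A M L Lcl).
by exists N.
Qed.

Definition sum_submod N K : M -> Prop :=
  fun x => exists2 n, N n & exists2 k, K k & x = n + k.

Lemma submod_add N K : submodule N -> submodule K -> submodule (sum_submod N K).
Proof.
move=> sN sK; split.
- by exists 0; [apply: submod0|exists 0; [apply: submod0|rewrite addr0]].
- move=> _ _ [n Nn [k Kk ->]] [n' Nn' [k' Kk' ->]].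
  exists (n + n'); first exact: submodD.
  by exists (k + k'); [apply: submodD|rewrite addrACA].
- move=> a _ [n Nn [k Kk ->]]; exists (a *: n); first exact: submodZ.
  by exists (a *: k); [apply: submodZ|rewrite scalerDr].
Qed.

Lemma sum_submodl N K x : submodule K -> N x -> sum_submod N K x.
Proof. by move=> sK Nx; exists x => //; exists 0; [apply: submod0|rewrite addr0]. Qed.

Lemma sum_submodr N K x : submodule N -> K x -> sum_submod N K x.
Proof. by move=> sN Kx; exists 0; [apply: submod0|exists x; rewrite ?add0r]. Qed.

Definition cyclic y : M -> Prop := fun x => exists a, x = a *: y.

Lemma submod_cyclic y : submodule (cyclic y).
Proof.
split; first by exists 0; rewrite scale0r.
  by move=> _ _ [a ->] [b ->]; exists (a + b); rewrite scalerDl.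
by move=> a _ [b ->]; exists (a * b); rewrite scalerA.
Qed.

Lemma cyclic_id y : cyclic y y. Proof. by exists 1; rewrite scale1r. Qed.

(** Maximal ideals, complements and maximal partial homomorphisms are all submodules
   maximal among those avoiding some bad elements; maximality is expressed by what
   the adjunction of one more element y produces. *)
Lemma zorn_avoid N0 (bad : M -> Prop) :
  submodule N0 -> (forall x, N0 x -> ~ bad x) ->
  exists N, [/\ submodule N, forall x, N0 x -> N x, forall x, N x -> ~ bad x &
    forall y, ~ N y -> exists n a, N n /\ bad (n + a *: y)].
Proof.
move=> sN0 aN0.
(* The union with N0 makes the empty chain admissible. *)
pose Q (S : M -> Prop) := let U x := S x \/ N0 x in
  submodule U /\ forall x, U x -> ~ bad x.
have Q0 : Q (fun=> False).
  split=> [|x [//|/aN0//]]; split; first by right; apply: submod0.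
    by move=> x y [//|Nx] [//|Ny]; right; apply: submodD.
  by move=> a x [//|Nx]; right; apply: submodZ.
have [|S [[sU aU] maxS]] := @classical_sets.Zorn_bigcup M Q.
  move=> C CQ totC.
  have [[S0 CS0]|C0] := pselect (exists S, C S); last first.
    suff -> : classical_sets.bigcup C (fun X => X) = (fun=> False) by [].
    by apply/funext=> x; apply/propext; split=> // -[S CS _]; apply: C0; exists S.
  have two x y : (exists2 S, C S & S x \/ N0 x) ->
      (exists2 S, C S & S y \/ N0 y) ->
      exists2 S, C S & (S x \/ N0 x) /\ (S y \/ N0 y).
    move=> [S CS Sx] [S' CS' Sy]; have [SS'|S'S] := totC _ _ CS CS'.
      by exists S' => //; split=> //; case: Sx => [/SS'|]; [left|right].
    by exists S => //; split=> //; case: Sy => [/S'S|]; [left|right].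
  have UE x : (classical_sets.bigcup C (fun X => X) x \/ N0 x) <->
              (exists2 S, C S & S x \/ N0 x).
    split=> [[[S CS Sx]|Nx]|[S CS [Sx|Nx]]]; first by exists S => //; left.
    - by exists S0 => //; right.
    - by left; exists S.
    - by right.
  split; last by move=> x /UE[S CS Sx]; apply: (CQ _ CS).2.
  split; first by right; apply: submod0.
    move=> x y /UE Ux /UE Uy; apply/UE; have [S CS [Sx Sy]] := two _ _ Ux Uy.
    by exists S => //; apply: submodD (CQ _ CS).1 Sx Sy.
  move=> a x /UE[S CS Sx]; apply/UE; exists S => //.
  by apply: submodZ (CQ _ CS).1 Sx.
exists (fun x => S x \/ N0 x); split=> //; first by move=> x; right.
move=> y nUy; apply: contrapT => nobad.
set U := fun x => S x \/ N0 x in sU aU nUy nobad.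
have sV := submod_add sU (submod_cyclic y).
have Uy : sum_submod U (cyclic y) y by apply: sum_submodr sU (cyclic_id y).
apply: (maxS (sum_submod U (cyclic y))).
  split; first by move=> x Sx; apply: sum_submodl; [apply: submod_cyclic|left].
  by move=> /(_ y Uy) Sy; apply: nUy; left.
have VE x : sum_submod U (cyclic y) x \/ N0 x <-> sum_submod U (cyclic y) x.
  split=> [[//|Nx]|]; last by left.
  by apply: sum_submodl; [apply: submod_cyclic|right].
split.
  suff -> : (fun x => sum_submod U (cyclic y) x \/ N0 x) = sum_submod U (cyclic y).
    exact: sV.
  by apply/funext=> x; apply/propext.
move=> x /VE[n Un [_ [a ->] ->]] b; apply: nobad; exists n, a; split=> //.
Qed.

End Submodules.

(** * One-sided ideals *)

Section OneSidedIdeals.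
Variable A : pzRingType.
Implicit Types (P I T m : A -> Prop) (f : A -> A).

(** One-sided notions are predicates on the carrier of the ring. Those of the converse
   ring are then convertible to those of the opposite side, so that every statement
   gives its mirror image by instantiation at the converse ring. *)
Definition lideal P : Prop :=
  [/\ P 0, forall x y, P x -> P y -> P (x + y) & forall a x, P x -> P (a * x)].
Definition rideal P : Prop :=
  [/\ P 0, forall x y, P x -> P y -> P (x + y) & forall a x, P x -> P (x * a)].

Definition rmax m : Prop :=
  [/\ rideal m, ~ m 1 & forall y, ~ m y -> exists n r, m n /\ 1 = n + y * r].
Definition lmax m : Prop :=
  [/\ lideal m, ~ m 1 & forall y, ~ m y -> exists n r, m n /\ 1 = n + r * y].

(** Baer's form of self-injectivity; f is a total function of which only the values
   on P matter. *)
Definition rself_inj : Prop := forall P f, rideal P ->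
  (forall x y, P x -> P y -> f (x + y) = f x + f y) ->
  (forall a x, P x -> f (x * a) = f x * a) ->
  exists b, forall x, P x -> f x = b * x.
Definition lself_inj : Prop := forall P f, lideal P ->
  (forall x y, P x -> P y -> f (x + y) = f x + f y) ->
  (forall a x, P x -> f (a * x) = a * f x) ->
  exists b, forall x, P x -> f x = x * b.

(** Chains are only asked to pause once, which is what a strictly monotone chain
   contradicts; lacc_stable recovers that they are eventually constant. *)
Definition racc : Prop := forall N : nat -> A -> Prop,
  (forall n, rideal (N n)) -> (forall n x, N n x -> N n.+1 x) ->
  exists n, forall x, N n.+1 x -> N n x.
Definition lacc : Prop := forall N : nat -> A -> Prop,
  (forall n, lideal (N n)) -> (forall n x, N n x -> N n.+1 x) ->
  exists n, forall x, N n.+1 x -> N n x.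
Definition rdcc : Prop := forall N : nat -> A -> Prop,
  (forall n, rideal (N n)) -> (forall n x, N n.+1 x -> N n x) ->
  exists n, forall x, N n x -> N n.+1 x.

Lemma rideal0 P : rideal P -> P 0. Proof. by case. Qed.
Lemma ridealD P x y : rideal P -> P x -> P y -> P (x + y).
Proof. by case=> _ + _; apply. Qed.
Lemma ridealM P a x : rideal P -> P x -> P (x * a).
Proof. by case=> _ _; apply. Qed.
Lemma ridealN P x : rideal P -> P x -> P (- x).
Proof. by move=> sP Px; rewrite -mulrN1; apply: ridealM. Qed.
Lemma ridealB P x y : rideal P -> P x -> P y -> P (x - y).
Proof. by move=> sP Px Py; apply: ridealD => //; apply: ridealN. Qed.

Lemma lideal0 P : lideal P -> P 0. Proof. by case. Qed.
Lemma lidealD P x y : lideal P -> P x -> P y -> P (x + y).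
Proof. by case=> _ + _; apply. Qed.
Lemma lidealM P a x : lideal P -> P x -> P (a * x).
Proof. by case=> _ _; apply. Qed.
Lemma lidealN P x : lideal P -> P x -> P (- x).
Proof. by move=> sP Px; rewrite -mulN1r; apply: lidealM. Qed.
Lemma lidealB P x y : lideal P -> P x -> P y -> P (x - y).
Proof. by move=> sP Px Py; apply: lidealD => //; apply: lidealN. Qed.

Lemma zorn_avoid_lideal N0 (bad : A -> Prop) :
  lideal N0 -> (forall x, N0 x -> ~ bad x) ->
  exists N, [/\ lideal N, forall x, N0 x -> N x, forall x, N x -> ~ bad x &
    forall y, ~ N y -> exists n a, N n /\ bad (n + a * y)].
Proof. exact: (@zorn_avoid A A^o). Qed.

Lemma lmax_exists P : lideal P -> ~ P 1 -> exists2 m, lmax m & forall x, P x -> m x.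
Proof.
move=> sP P1; have [|m [sm Pm am mm]] := @zorn_avoid_lideal P (fun x => x = 1) sP.
  by move=> x Px x1; apply: P1; rewrite -x1.
exists m => //; split=> //; first by move=> m1; apply: am m1 _.
by move=> y /mm[n [a [mn e]]]; exists n, a.
Qed.

End OneSidedIdeals.

Section RightIdeals.
Variable A : pzRingType.
Implicit Types P N : A -> Prop.

Lemma zorn_avoid_rideal N0 (bad : A -> Prop) :
  rideal N0 -> (forall x, N0 x -> ~ bad x) ->
  exists N, [/\ rideal N, forall x, N0 x -> N x, forall x, N x -> ~ bad x &
    forall y, ~ N y -> exists n a, N n /\ bad (n + y * a)].
Proof. exact: (@zorn_avoid_lideal A^c). Qed.

Lemma rmax_exists P : rideal P -> ~ P 1 -> exists2 m, rmax m & forall x, P x -> m x.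
Proof. exact: (@lmax_exists A^c). Qed.

End RightIdeals.

(** * The radical of a right self-injective ring *)

Section MaximalIdeals.
Variable A : pzRingType.

Lemma maximal_submod_lmax (I : submodClosed A^o) :
  maximal_submod I <-> @lmax A (fun x => (x : A^o) \in I).
Proof.
have sI := submod_in I; split=> [[[x xI] mI]|[_ I1 mI]]; last first.
  split=> [|N sIN]; first by exists 1; apply/negP.
  have [[y Ny Iy]|H] := pselect (exists2 y, y \in N & y \notin I).
    right=> x; have [n [r [In e1]]] := mI y (negP Iy).
    rewrite -[x]mulr1 e1; apply: (rpredZ x); apply: rpredD; first exact: sIN.
    exact: rpredZ.
  left=> x; apply/idP/idP => [Nx|/sIN//].
  by apply: contrapT => /negP Ix; apply: H; exists x.
split=> //.
  by move=> I1; case/negP: xI; rewrite -[x]mulr1; apply: rpredZ.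
move=> y Iy; have sN := submod_add sI (submod_cyclic (y : A^o)).
have [N NE] := submod_closed_of sN.
have [|eqN|allN] := mI N; first 1 last.
- case: Iy; rewrite -eqN NE; apply/asboolP.
  by apply: sum_submodr sI _; apply: cyclic_id.
- have := allN 1; rewrite NE => /asboolP[n In [_ [r ->] e1]].
  by exists n, r.
by move=> z Iz; rewrite NE; apply/asboolP/sum_submodl => //; apply: submod_cyclic.
Qed.

Lemma lmax_maximal_submod (m : A -> Prop) : @lmax A m ->
  exists2 I : submodClosed A^o, maximal_submod I & forall x, (x \in I) = `[< m x >].
Proof.
move=> mm; have [sm _ _] := mm; have [I IE] := @submod_closed_of A A^o m sm.
exists I => //; apply/maximal_submod_lmax.
suff -> : (fun x => (x : A^o) \in I : Prop) = m by [].
by apply/funext=> x; rewrite IE; apply/propext; split=> /asboolP.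
Qed.

End MaximalIdeals.

Lemma jacobson_rmax (R : pzRingType) (x : R) :
  x \in @jacobson R <-> forall m, @rmax R m -> m x.
Proof.
split=> [/jacobsonP Jx m mm|Jx].
  have [I mI IE] := @lmax_maximal_submod R^c m mm.
  by have := Jx I mI; rewrite IE => /asboolP.
by apply/jacobsonP=> I /maximal_submod_lmax; apply: Jx.
Qed.

Section SelfInjective.
Variable R : pzRingType.
Implicit Types (a b c x y z : R).

(** The maps to be extended send expressions like bu to xu. Giving them as graphs
   avoids choosing u, and well-definedness becomes a condition at 0. *)
Lemma rself_inj_graph (G : R -> R -> Prop) : rself_inj R ->
  G 0 0 -> (forall x x' y y', G x y -> G x' y' -> G (x + x') (y + y')) ->
  (forall r x y, G x y -> G (x * r) (y * r)) -> (forall y, G 0 y -> y = 0) ->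
  exists c, forall x y, G x y -> y = c * x.
Proof.
move=> injR G0 GD GM Gfun.
have Guniq x y y' : G x y -> G x y' -> y = y'.
  move=> Gxy Gxy'; apply/eqP; rewrite -subr_eq0; apply/eqP/Gfun.
  rewrite -(subrr x) -[- x]mulrN1 -[- y']mulrN1.
  by apply: GD => //; apply: GM.
have /choice[f fP] x : exists y, (exists z, G x z) -> G x y.
  by have [[y Gxy]|nG] := pselect (exists y, G x y); [exists y|exists 0].
have [|x y [x' Gx] [y' Gy]|a x [y Gxy]|c cP] := injR (fun x => exists y, G x y) f.
- split; first by exists 0.
    by move=> x x' [y Gy] [y' Gy']; exists (y + y'); apply: GD.
  by move=> a x [y Gy]; exists (y * a); apply: GM.
- apply: (@Guniq (x + y)); first by apply: fP; exists (x' + y'); apply: GD.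
  by apply: GD; apply: fP; [exists x'|exists y'].
- apply: (@Guniq (x * a)); first by apply: fP; exists (y * a); apply: GM.
  by apply: GM; apply: fP; exists y.
exists c => x y Gxy; rewrite -cP; last by exists y.
by apply: (Guniq _ _ _ Gxy); apply: fP; exists y.
Qed.

Lemma rself_inj_dvd a b : rself_inj R ->
  (forall r, a * r = 0 -> b * r = 0) -> exists c, b = c * a.
Proof.
move=> injR ab; have [||||c cP] :=
  @rself_inj_graph (fun x y => exists2 r, x = a * r & y = b * r) injR.
- by exists 0; rewrite mulr0.
- by move=> ? ? ? ? [r -> ->] [s -> ->]; exists (r + s); rewrite mulrDr.
- by move=> t ? ? [r -> ->]; exists (r * t); rewrite mulrA.
- by move=> _ [r /esym/ab e ->].
by exists c; apply: cP; exists 1; rewrite mulr1.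
Qed.

(** The right singular ideal: the right annihilator of a is essential. *)
Definition rsing a : Prop := forall x, x != 0 -> exists2 r, x * r != 0 & a * (x * r) = 0.

Lemma rsingMl c a : rsing a -> rsing (c * a).
Proof. by move=> Za x /Za[r xr axr]; exists r; rewrite // -mulrA axr mulr0. Qed.

Lemma rsingMr a c : rsing a -> rsing (a * c).
Proof.
move=> Za x x0; have [cx0|/Za[r cxr acxr]] := eqVneq (c * x) 0.
  by exists 1; rewrite ?mulr1 // -mulrA cx0 mulr0.
exists r; last by rewrite -mulrA [c * _]mulrA.
by apply: contra cxr => /eqP xr; rewrite -mulrA xr mulr0.
Qed.

Lemma rsingN a : rsing a -> rsing (- a).
Proof. by move=> Za; rewrite -mulN1r; apply: rsingMl. Qed.

(** As ann(z) is essential and meets ann(1 - z) in 0, left multiplication by 1 - z is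
   injective, and its inverse (1 - z)r -> r extends to R. So 1 - z has a left inverse
   u, and u = 1 + uz has one as well. *)
Lemma rsing_unit z : rself_inj R -> rsing z ->
  exists2 u, u * (1 - z) = 1 & (1 - z) * u = 1.
Proof.
move=> injR; have linv y : rsing y -> exists u, u * (1 - y) = 1.
  move=> Zy; have [r|u e] := @rself_inj_dvd (1 - y) 1 injR; last by exists u.
  move=> yr; rewrite mul1r; apply: contrapT => /eqP/Zy[s rs yrs].
  by case/eqP: rs; rewrite -[_ * _]subr0 -yrs -[X in X - _]mul1r -mulrBl mulrA yr mul0r.
move=> Zz; have [u uz] := linv z Zz; exists u => //.
have uE : u = 1 - - (u * z) by rewrite opprK -[in RHS]uz mulrBr mulr1 subrK.
have [|v vu] := linv (- (u * z)); first by apply/rsingN/rsingMl.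
rewrite -uE in vu.
by rewrite -[1 - z]mul1r -{1}vu -[v * u * _]mulrA uz mulr1.
Qed.

(** Given a, pick K maximal with K meeting ann(a) trivially; a is injective on K,
   so self-injectivity gives b with ba = id on K, and a - aba vanishes on K + ann(a). *)
Lemma rsing_regular a : rself_inj R -> exists b, rsing (a - a * b * a).
Proof.
move=> injR.
have [||K [rK _ aK mK]] := @zorn_avoid_rideal R (fun x => x = 0)
  (fun x => a * x = 0 /\ x != 0).
- by split=> [|x y -> ->|r x ->]; rewrite ?addr0 ?mul0r.
- by move=> x -> [_ /eqP].
have [||||b bP] :=
    @rself_inj_graph (fun x y => exists2 k, K k & x = a * k /\ y = k) injR.
- by exists 0; [apply: rideal0 rK|split; rewrite ?mulr0].
- move=> _ _ _ _ [k Kk [-> ->]] [l Kl [-> ->]]; exists (k + l); first exact: (ridealD rK Kk Kl).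
  by rewrite mulrDr.
- move=> r _ _ [k Kk [-> ->]]; exists (k * r); first exact: (ridealM r rK Kk).
  by rewrite mulrA.
- move=> _ [k Kk [/esym ak ->]]; apply: contrapT => /eqP k0.
  exact: (aK k Kk).
have kill k : K k -> (a - a * b * a) * k = 0.
  by move=> Kk; rewrite mulrBl -!mulrA -(bP _ k) ?subrr //; exists k.
exists b => x x0; have [Kx|nKx] := pselect (K x).
  by exists 1; rewrite mulr1 // kill.
have [n [r [Kn [aw w0]]]] := mK x nKx.
exists r; last first.
  rewrite -[x * r](addKr n) [- n + _]addrC mulrBr (kill n Kn) subr0.
  by rewrite mulrBl -!mulrA aw !mulr0 subr0.
apply: contraNneq w0 => xr0; rewrite xr0 addr0 in aw *.
by apply: contrapT => /negP n0; apply: (aK n Kn).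
Qed.

(** Singular elements are quasi-regular by rsing_unit. Conversely, for a in the radical
   and b with a - aba = (1 - ab)a singular, 1 - ab is a unit. *)
Lemma jacobson_rsing a : rself_inj R -> (a \in @jacobson R) <-> rsing a.
Proof.
move=> injR; split=> [Ja|Za].
  have Junit z : z \in @jacobson R -> exists u, (1 - z) * u = 1.
    move=> Jz; pose P x := exists u, x = (1 - z) * u.
    have sP : rideal P.
      split; first by exists 0; rewrite mulr0.
        by move=> _ _ [u ->] [v ->]; exists (u + v); rewrite mulrDr.
      by move=> r _ [u ->]; exists (u * r); rewrite mulrA.
    apply: contrapT => nP; have [[u e]|m mm Pm] := rmax_exists sP.
      by apply: nP; exists u.
    have [sm m1 _] := mm; apply: m1; rewrite -(subrK z 1); apply: ridealD => //.
      by apply: Pm; exists 1; rewrite mulr1.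
    by move/jacobson_rmax: Jz; apply.
  have [b Zb] := rsing_regular a injR.
  have Jab : a * b \in @jacobson R by apply: jacobsonMr.
  have [u abu] := Junit _ Jab.
  have uE : u = 1 - - (a * b * u).
    by rewrite opprK -[X in X + _]abu mulrBl mul1r subrK.
  have [|v uv] := Junit (- (a * b * u)).
    by rewrite rpredN; apply: jacobsonMr.
  rewrite -uE in uv.
  have vE : v = 1 - a * b by rewrite -[LHS]mul1r -[in LHS]abu -mulrA uv mulr1.
  rewrite -[a]mul1r -uv vE -mulrA mulrBl mul1r; exact: rsingMl.
apply/jacobson_rmax=> m [sm m1 mm]; apply: contrapT => /mm[n [r [mn e1]]].
have [u _ uz] := rsing_unit injR (rsingMr r Za).
by apply: m1; rewrite -uz; apply: ridealM => //; rewrite e1 addrK.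
Qed.

End SelfInjective.

Lemma lself_inj_graph (R : pzRingType) (G : R -> R -> Prop) : @lself_inj R ->
  G 0 0 -> (forall x x' y y', G x y -> G x' y' -> G (x + x') (y + y')) ->
  (forall r x y, G x y -> G (r * x) (r * y)) -> (forall y, G 0 y -> y = 0) ->
  exists c, forall x y, G x y -> y = x * c.
Proof. exact: (@rself_inj_graph R^c). Qed.

(** * Chain conditions, Nakayama's lemma and regular rings *)

Section ChainConditions.
Variable A : pzRingType.
Implicit Types P : A -> Prop.

Lemma lacc_max (F : (A -> Prop) -> Prop) P0 : @lacc A ->
  (forall P, F P -> lideal P) -> F P0 ->
  exists2 P, F P & forall P', F P' -> (forall x, P x -> P' x) -> forall x, P' x -> P x.
Proof.
move=> acc FI FP0; apply: contrapT => nomax.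
have [[P FP]|f _ fS] := @dependent_choice {P | F P} (exist _ P0 FP0)
  (fun N N' => (forall x, sval N x -> sval N' x) /\ exists2 x, sval N' x & ~ sval N x).
  apply: contrapT => noP'; apply: nomax; exists P => // P' FP' sPP' x P'x.
  apply: contrapT => Px; apply: noP'; exists (exist _ P' FP'); split=> //.
  by exists x.
have [n nmax] := acc (fun n => sval (f n)) (fun n => FI _ (svalP (f n)))
  (fun n => (fS n).1).
by have [_ [x /nmax]] := fS n.
Qed.

Lemma lacc_stable (N : nat -> A -> Prop) : @lacc A ->
  (forall n, lideal (N n)) -> (forall n x, N n x -> N n.+1 x) ->
  exists n, forall m, (n <= m)%N -> forall x, N m x -> N n x.
Proof.
move=> acc lN NS; have FI P : (exists n, P = N n) -> lideal P by move=> [n ->].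
have [_ [n ->] maxn] := lacc_max acc FI (ex_intro _ 0%N erefl).
exists n => m le_nm; apply: maxn; first by exists m.
by move: le_nm => /subnK<- x; elim: (m - n)%N => // k IHk /IHk/NS.
Qed.

End ChainConditions.

Lemma racc_max (A : pzRingType) (F : (A -> Prop) -> Prop) P0 : @racc A ->
  (forall P, F P -> rideal P) -> F P0 ->
  exists2 P, F P & forall P', F P' -> (forall x, P x -> P' x) -> forall x, P' x -> P x.
Proof. exact: (@lacc_max A^c). Qed.

Lemma rdcc_min (A : pzRingType) (F : (A -> Prop) -> Prop) P0 : @rdcc A ->
  (forall P, F P -> rideal P) -> F P0 ->
  exists2 P, F P & forall P', F P' -> (forall x, P' x -> P x) -> forall x, P x -> P' x.
Proof.
move=> dcc FI FP0; apply: contrapT => nomin.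
have [[P FP]|f _ fS] := @dependent_choice {P | F P} (exist _ P0 FP0)
  (fun P P' => (forall x, sval P' x -> sval P x) /\ exists2 x, sval P x & ~ sval P' x).
  apply: contrapT => noP'; apply: nomin; exists P => // P' FP' sPP' x P'x.
  apply: contrapT => Px; apply: noP'; exists (exist _ P' FP'); split=> //.
  by exists x.
have [n nmin] := dcc (fun n => sval (f n)) (fun n => FI _ (svalP (f n)))
  (fun n => (fS n).1).
by have [_ [x /nmin]] := fS n.
Qed.

Section Nakayama.
Variables (A : pzRingType) (M : lmodType A) (J : A -> Prop).
Implicit Types (N : M -> Prop) (s : seq M).

Fixpoint spans s : M -> Prop :=
  if s is x :: s' then sum_submod (spans s') (cyclic x) else fun x => x = 0.

Lemma submod_spans s : submodule (spans s).
Proof.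
by elim: s => [|x s IHs]; [apply: submod_zero|apply/submod_add/submod_cyclic].
Qed.

Lemma mem_spans s x : x \in s -> spans s x.
Proof.
elim: s => // y s IHs; rewrite inE => /predU1P[->|/IHs sx] /=.
  exact: sum_submodr (submod_spans s) (cyclic_id y).
exact: sum_submodl (submod_cyclic y) sx.
Qed.

Lemma spans_sub (K : M -> Prop) s : submodule K ->
  (forall x, x \in s -> K x) -> forall x, spans s x -> K x.
Proof.
move=> sK; elim: s => [|y s IHs] sP x /=; first by move=> ->; apply: submod0.
move=> [z sz [_ [a ->] ->]]; apply: submodD => //.
  by apply: IHs sz => w ws; apply: sP; rewrite inE ws orbT.
by apply: submodZ => //; apply: sP; rewrite inE eqxx.
Qed.

(** The submodule JN, as the smallest one containing the products. *)
Definition ideal_mul N : M -> Prop := fun x =>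
  forall K, submodule K -> (forall a n, J a -> N n -> K (a *: n)) -> K x.

Lemma submod_ideal_mul N : submodule (ideal_mul N).
Proof.
split=> [K sK _|x y Nx Ny K sK JN|a x Nx K sK JN]; first exact: submod0.
  by apply: submodD => //; [apply: Nx|apply: Ny].
by apply: submodZ => //; apply: Nx.
Qed.

Lemma mem_ideal_mul N a x : J a -> N x -> ideal_mul N (a *: x).
Proof. by move=> Ja Nx K sK; apply. Qed.

(** If N = S + Ax and x is in JN then x = ax + n with a in J and n in S, so x is in
   S as 1 - a is left invertible; the induction strips the generators one by one. *)
Lemma nakayama s : lideal J -> rideal J -> (forall a, J a -> exists u, u * (1 - a) = 1) ->
  (forall x, spans s x -> ideal_mul (spans s) x) -> forall x, spans s x -> x = 0.
Proof.
move=> lJ rJ uJ; elim: s => //= x s IHs sJ.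
have sS := submod_spans s.
have [||a Ja [n Sn xE]] := sJ x (sum_submodr sS (cyclic_id x))
    (fun y => exists2 a, J a & exists2 n, spans s n & y = a *: x + n).
- split.
  + exists 0; first exact: lideal0; exists 0; first exact: submod0.
    by rewrite scale0r addr0.
  + move=> _ _ [a Ja [n Sn ->]] [b Jb [m Sm ->]]; exists (a + b).
      exact: lidealD.
    exists (n + m); first exact: submodD.
    by rewrite scalerDl addrACA.
  + move=> r _ [a Ja [n Sn ->]]; exists (r * a); first exact: lidealM.
    by exists (r *: n); [apply: submodZ|rewrite scalerDr scalerA].
- move=> a _ Ja [n Sn [_ [r ->] ->]]; exists (a * r); first exact: ridealM.
  by exists (a *: n); [apply: submodZ|rewrite scalerDr scalerA addrC].
have Sx : spans s x.
  have [u ua] := uJ a Ja; rewrite -[x]scale1r -ua -scalerA; apply: submodZ => //.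
  by rewrite scalerBl scale1r {1}xE addrC addKr.
have NS y : sum_submod (spans s) (cyclic x) y -> spans s y.
  by move=> [n' Sn' [_ [r ->] ->]]; apply: submodD => //; apply: submodZ.
move=> y /NS Sy; apply: IHs Sy => z Sz K sK JK; apply: sJ => //.
  exact: sum_submodl (submod_cyclic x) Sz.
by move=> b m Jb /NS; apply: JK.
Qed.

End Nakayama.

Lemma lacc_spans (A : pzRingType) (P : A -> Prop) : @lacc A -> lideal P ->
  exists s : seq A^o, forall x, P x <-> spans s x.
Proof.
move=> acc lP; pose F (N : A -> Prop) := exists2 s : seq A^o,
  (forall x : A, x \in s -> P x) & N = spans s.
have FI N : F N -> lideal N by move=> [s _ ->]; exact: (submod_spans s).
have F0 : F (fun x => x = 0) by exists [::].
have [N [s sP ->] maxs] := lacc_max acc FI F0.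
exists s => x; split=> [Px|].
  apply: (maxs (spans (x :: s : seq A^o))).
  - by exists (x :: s) => // y; rewrite inE => /predU1P[->//|]; apply: sP.
  - by move=> y sy; apply: sum_submodl sy; apply: submod_cyclic.
  - by apply: mem_spans; rewrite inE eqxx.
exact: (@spans_sub A A^o P s lP).
Qed.

(** Take a maximal idempotent e of P. If a in P had b = a - ea nonzero, then with
   b = bcb the idempotent g = bc satisfies eg = 0, and e + (g - ge) is larger. *)
Lemma regular_rideal_idem (Q : pzRingType) (P : Q -> Prop) :
  (forall a : Q, exists b, a = a * b * a) -> @lacc Q \/ @racc Q -> rideal P ->
  exists2 g, P g & forall x, P x -> x = g * x.
Proof.
move=> reg acc rP; apply: contrapT => nog.
have [|f _ fS] := @dependent_choice {e | P e /\ e * e = e}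
  (exist _ 0 (conj (rideal0 rP) (mulr0 0)))
  (fun e e' => [/\ sval e * sval e' = sval e, sval e' * sval e = sval e &
    sval e' <> sval e]).
- move=> [e [Pe ee]] /=.
  have [a Pa aea] : exists2 a, P a & a <> e * a.
    apply: contrapT => noa; apply: nog; exists e => // x Px.
    by apply: contrapT => nx; apply: noa; exists x.
  pose b := a - e * a; have [c bE] := reg b.
  have b0 : b <> 0 by move/eqP; rewrite subr_eq0 => /eqP.
  pose g := b * c; have gg : g * g = g by rewrite /g mulrA -bE.
  have eg : e * g = 0 by rewrite /g mulrA mulrBr mulrA ee subrr mul0r.
  pose g' := g - g * e.
  have eg' : e * g' = 0 by rewrite mulrBr mulrA eg mul0r subrr.
  have g'e : g' * e = 0 by rewrite mulrBl -[g * e * e]mulrA ee subrr.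
  have g'g : g' * g = g by rewrite mulrBl gg -[g * e * g]mulrA eg mulr0 subr0.
  have Pg : P g by apply: ridealM => //; apply: ridealB => //; apply: ridealM.
  have ege : (e + g') * (e + g') = e + g'.
    have g'g' : g' * g' = g' by rewrite {2}/g' mulrBr mulrA g'g.
    by rewrite mulrDl [e * _]mulrDr [g' * _]mulrDr ee eg' addr0 g'e add0r g'g'.
  have Pe' : P (e + g').
    by apply: ridealD => //; apply: ridealB => //; apply: ridealM.
  exists (exist _ (e + g') (conj Pe' ege)); split=> /=.
  + by rewrite mulrDr eg' addr0.
  + by rewrite mulrDl g'e addr0.
  + rewrite -[X in _ = X]addr0 => /addrI g'0; apply: b0.
    by rewrite bE -/g -g'g g'0 !mul0r.
case: acc => acc.
  have [n|n x xf|n nmax] := acc (fun n x => x * sval (f n) = x).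
  - split=> [|x y xf yf|a x xf]; first by rewrite mul0r.
      by rewrite mulrDl xf yf.
    by rewrite -mulrA xf.
  - by have [ff' _ _] := fS n; rewrite -xf -mulrA ff'.
  have [_ f'f] := fS n; case; rewrite -f'f; symmetry; apply: nmax.
  exact: (svalP (f n.+1)).2.
have [n|n x xf|n nmax] := acc (fun n x => sval (f n) * x = x).
- split=> [|x y xf yf|a x xf]; first by rewrite mulr0.
    by rewrite mulrDr xf yf.
  by rewrite mulrA xf.
- by have [_ f'f _] := fS n; rewrite -xf mulrA f'f.
have [ff' _] := fS n; case; rewrite -ff'; symmetry; apply: nmax.
exact: (svalP (f n.+1)).2.
Qed.

Lemma regular_lideal_idem (Q : pzRingType) (P : Q -> Prop) :
  (forall a : Q, exists b, a = a * b * a) -> @lacc Q \/ @racc Q -> lideal P ->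
  exists2 g, P g & forall x, P x -> x = x * g.
Proof.
move=> reg acc; apply: (@regular_rideal_idem Q^c); last by case: acc; [right|left].
by move=> a; have [b ab] := reg a; exists b; rewrite [LHS]ab -mulrA.
Qed.

(** * Annihilators and nilpotence of the radical *)

Section SelfInjectiveCore.
Variables (R : pzRingType) (injR : @rself_inj R).
Implicit Types (P B T m : R -> Prop) (x y : R).

Local Notation J := (@jacobson R).

Lemma lideal_jacobson : lideal (fun x => x \in J).
Proof.
by split=> [|x y Jx Jy|a x]; [apply: rpred0|apply: rpredD|apply: jacobsonMl].
Qed.

Lemma rideal_jacobson : rideal (fun x => x \in J).
Proof.
by split=> [|x y Jx Jy|a x]; [apply: rpred0|apply: rpredD|apply: jacobsonMr].
Qed.

Lemma jacobson_unit x : x \in J -> exists2 u, u * (1 - x) = 1 & (1 - x) * u = 1.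
Proof. by move/(jacobson_rsing x injR); apply: rsing_unit. Qed.

Lemma jacobson_sub_rmax m x : rmax m -> x \in J -> m x.
Proof. by move=> mm /jacobson_rmax; apply. Qed.

Lemma quot_piM x y : qjac_pi (x * y) = qjac_pi x * qjac_pi y.
Proof. exact: qjac_piM. Qed.

Lemma quot_regular (q : quot_jacobson R) : exists b, q = q * b * q.
Proof.
have [a <-] := qjac_pi_surj q; have [b /(jacobson_rsing _ injR) ab] := rsing_regular a injR.
by exists (qjac_pi b); apply/eqP; rewrite -!quot_piM qjac_piE.
Qed.

Lemma quot_acc : @lacc R \/ @racc R ->
  @lacc (quot_jacobson R) \/ @racc (quot_jacobson R).
Proof.
case=> acc; [left|right] => N lN NS.
  have [n|n x|n nP] := acc (fun n x => N n (qjac_pi x)); last 1 first.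
  - by exists n => q; have [x <-] := qjac_pi_surj q; apply: nP.
  - split=> [|x y Nx Ny|a x Nx]; rewrite ?raddf0 ?raddfD ?quot_piM /=.
    + exact: lideal0.
    + exact: lidealD.
    + exact: lidealM.
  - exact: NS.
have [n|n x|n nP] := acc (fun n x => N n (qjac_pi x)); last 1 first.
- by exists n => q; have [x <-] := qjac_pi_surj q; apply: nP.
- split=> [|x y Nx Ny|a x Nx]; rewrite ?raddf0 ?raddfD ?quot_piM /=.
  + exact: rideal0.
  + exact: ridealD.
  + exact: ridealM.
- exact: NS.
Qed.

(** R/J is von Neumann regular with a chain condition, so the image of P there is
   generated by an idempotent. With lideal_idem this is the form in which the
   semisimplicity of R/J is used: a maximal right ideal m is gR + J, and 1 - g
   annihilates it modulo J. *)
Lemma rideal_idem P : @lacc R \/ @racc R -> rideal P ->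
  exists2 g, P g & forall x, P x -> x - g * x \in J.
Proof.
move=> acc rP.
have [|_ [g Pg <-] gP] := @regular_rideal_idem _ (fun q => exists2 x, P x & qjac_pi x = q)
  quot_regular (quot_acc acc).
- split; first by exists 0; [apply: rideal0|rewrite raddf0].
    move=> _ _ [x Px <-] [y Py <-]; exists (x + y); rewrite ?raddfD //.
    exact: ridealD.
  move=> a _ [x Px <-]; have [b <-] := qjac_pi_surj a.
  by exists (x * b); [apply: ridealM|rewrite quot_piM].
exists g => // x Px; rewrite -qjac_piE quot_piM; apply/eqP/gP.
by exists x.
Qed.

Lemma lideal_idem P : @lacc R \/ @racc R -> lideal P ->
  exists2 g, P g & forall x, P x -> x - x * g \in J.
Proof.
move=> acc lP.
have [|_ [g Pg <-] gP] := @regular_lideal_idem _ (fun q => exists2 x, P x & qjac_pi x = q)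
  quot_regular (quot_acc acc).
- split; first by exists 0; [apply: lideal0|rewrite raddf0].
    move=> _ _ [x Px <-] [y Py <-]; exists (x + y); rewrite ?raddfD //.
    exact: lidealD.
  move=> a _ [x Px <-]; have [b <-] := qjac_pi_surj a.
  by exists (b * x); [apply: lidealM|rewrite quot_piM].
exists g => // x Px; rewrite -qjac_piE quot_piM; apply/eqP/gP.
by exists x.
Qed.

Definition annr B : R -> Prop := fun u => forall b, B b -> b * u = 0.
Definition annl P : R -> Prop := fun u => forall x, P x -> u * x = 0.

Lemma rideal_annr B : rideal (annr B).
Proof.
split=> [b _|u v Bu Bv b Bb|r u Bu b Bb]; first by rewrite mulr0.
  by rewrite mulrDr Bu ?Bv ?addr0.
by rewrite mulrA Bu ?mul0r.
Qed.

Lemma lideal_annl P : lideal (annl P).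
Proof.
split=> [b _|u v Bu Bv b Bb|r u Bu b Bb]; first by rewrite mul0r.
  by rewrite mulrDl Bu ?Bv ?addr0.
by rewrite -mulrA Bu ?mulr0.
Qed.

(** Left ideals that are left annihilators. *)
Definition lclosed B : Prop := lideal B /\ forall x, annl (annr B) x -> B x.

Lemma lclosed0 : lclosed (fun x => x = 0).
Proof.
split; first by split=> [|x y -> ->|a x ->]; rewrite ?addr0 ?mulr0.
by move=> x x1; rewrite -[x]mulr1; apply: x1 => _ ->; rewrite mul0r.
Qed.

Definition ladj B b : R -> Prop := fun x => exists2 n, B n & exists r, x = n + r * b.

Lemma lideal_ladj B b : lideal B -> lideal (ladj B b).
Proof.
move=> lB; split.
- by exists 0; [apply: lideal0|exists 0; rewrite mul0r addr0].
- move=> _ _ [n Bn [r ->]] [n' Bn' [r' ->]]; exists (n + n'); first exact: lidealD.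
  by exists (r + r'); rewrite mulrDl addrACA.
- move=> a _ [n Bn [r ->]]; exists (a * n); first exact: lidealM.
  by exists (a * r); rewrite mulrDr mulrA.
Qed.

Lemma ladj_sub B b x : B x -> ladj B b x.
Proof. by exists x => //; exists 0; rewrite mul0r addr0. Qed.

Lemma ladj_id B b : lideal B -> ladj B b b.
Proof. by move=> lB; exists 0; [apply: lideal0|exists 1; rewrite mul1r add0r]. Qed.

(** If x kills ann(B) intersected with ann(b), the map b u -> x u on b ann(B) is
   well defined, hence is left multiplication by some y; then x - y b kills
   ann(B). *)
Lemma lclosed_ladj B b : lclosed B -> lclosed (ladj B b).
Proof.
move=> [lB cB]; split=> [|x xB]; first exact: lideal_ladj.
have [||||y yP] := @rself_inj_graph R
  (fun z w => exists2 u, annr B u & z = b * u /\ w = x * u) injR.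
- by exists 0; [apply: rideal0 (rideal_annr B)|rewrite !mulr0].
- move=> _ _ _ _ [u Bu [-> ->]] [v Bv [-> ->]]; exists (u + v).
    exact: ridealD (rideal_annr B) Bu Bv.
  by rewrite !mulrDr.
- move=> r _ _ [u Bu [-> ->]]; exists (u * r); last by rewrite !mulrA.
  exact: (ridealM r (rideal_annr B) Bu).
- move=> _ [u Bu [/esym bu ->]]; apply: xB => _ [n Bn [r ->]].
  by rewrite mulrDl Bu // -mulrA bu mulr0 addr0.
exists (x - y * b); last by exists y; rewrite subrK.
apply: cB => u Bu; rewrite mulrBl -mulrA -(yP _ (x * u)) ?subrr //.
by exists u.
Qed.

Lemma lacc_lclosed B : @lacc R -> lideal B -> lclosed B.
Proof.
move=> acc lB; have FI P : lclosed P /\ (forall x, P x -> B x) -> lideal P by case=> [[]].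
have F0 : lclosed (fun x => x = 0) /\ (forall x, x = 0 -> B x).
  by split=> [|x ->]; [apply: lclosed0|apply: lideal0].
have [P [cP PB] maxP] := lacc_max acc FI F0.
suff -> : B = P by [].
apply/funext=> x; apply/propext; split=> [Bx|/PB//].
apply: (maxP (ladj P x)); last exact: ladj_id cP.1.
  split; first exact: lclosed_ladj.
  by move=> _ [n /PB Bn [r ->]]; apply: lidealD => //; apply: lidealM.
by move=> y; apply: ladj_sub.
Qed.

(** The right annihilator of the k-th power of the radical. Quantifying over products
   lets a factor be split off at either end. *)
Definition loewy k x : Prop := forall s : seq R, size s = k ->
  all [in J] s -> (\prod_(a <- s) a) * x = 0.

Lemma loewy0 x : loewy 0 x <-> x = 0.
Proof.
split=> [|-> [|//] _ _]; last by rewrite mulr0.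
by move/(_ [::] erefl isT); rewrite big_nil mul1r.
Qed.

Lemma loewyS k x : loewy k.+1 x <-> forall a, a \in J -> loewy k (a * x).
Proof.
split=> [Lx a Ja s sk Js|Lx s].
  rewrite mulrA -big_rcons; apply: Lx; first by rewrite size_rcons sk.
  by rewrite all_rcons Ja.
case: (lastP s) => // t a; rewrite size_rcons all_rcons => -[tk] /andP[Ja Jt].
by rewrite big_rcons -mulrA; apply: Lx.
Qed.

Lemma loewy_sub k x : loewy k x -> loewy k.+1 x.
Proof.
move=> Lx [//|a s] [sk] /andP[_ Js].
by rewrite big_cons -mulrA Lx ?mulr0.
Qed.

Lemma loewy_lideal k : lideal (loewy k).
Proof.
split=> [s _ _|x y Lx Ly s sk Js|a x]; first by rewrite mulr0.
  by rewrite mulrDr Lx ?Ly ?addr0.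
case: k => [/loewy0->|k /loewyS Lx]; first by apply/loewy0; rewrite mulr0.
by apply/loewyS=> b Jb; rewrite mulrA; apply/Lx/jacobsonMr.
Qed.

Lemma loewy_rideal k : rideal (loewy k).
Proof.
split=> [s _ _|x y Lx Ly s sk Js|a x Lx s sk Js]; first by rewrite mulr0.
  by rewrite mulrDr Lx ?Ly ?addr0.
by rewrite mulrA Lx ?mul0r.
Qed.

(** Choose a outside the stable term L with ann(a) maximal. For b in J = Z(R) the
   essential ideal ann(b) meets aR, so ann(ba) is larger than ann(a) and ba is in
   L; hence a is in the next term, which is L. *)
Lemma racc_loewy : @racc R -> exists k, loewy k 1.
Proof.
move=> acc; have [n nmax] := acc _ loewy_rideal loewy_sub.
exists n; apply: contrapT => L1.
pose F P := exists2 a, ~ loewy n a & P = annr (fun x => x = a).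
have FI P : F P -> rideal P by move=> [a _ ->]; apply: rideal_annr.
have [_ [a La ->] maxa] := racc_max acc FI (ex_intro2 _ _ 1 L1 erefl).
apply/La/nmax/loewyS=> b /(jacobson_rsing b injR) Zb; apply: contrapT => Lba.
have [|r ar bar] := Zb a.
  by apply/eqP=> a0; apply: La; rewrite a0; apply: lideal0 (loewy_lideal n).
case/eqP: ar; apply: (maxa (annr (fun x => x = b * a))) => //.
- by exists (b * a).
- by move=> x ax _ ->; rewrite -mulrA ax ?mulr0.
- by move=> _ ->; rewrite -mulrA.
Qed.

(** Since every left ideal is an annihilator, the left annihilator P of the stable
   term satisfies P = JP, so P = 0 by Nakayama; and products of n elements of J
   are in P. *)
Lemma lacc_loewy : @lacc R -> exists k, loewy k 1.
Proof.
move=> acc; have [n nmax] := acc _ loewy_lideal loewy_sub.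
pose P := annl (loewy n); have lP : lideal P := lideal_annl _.
have Pprod s : size s = n -> all [in J] s -> P (\prod_(a <- s) a).
  by move=> sn Js x; apply.
have [s sP] := lacc_spans acc lP.
exists n => t tn Jt; rewrite mulr1.
apply: (@nakayama R R^o (fun x => x \in J) s lideal_jacobson rideal_jacobson); last first.
- exact/sP/Pprod.
- have -> : spans s = P :> (R^o -> Prop) by apply/funext=> x; apply/propext; rewrite sP.
  move=> p Pp; have lJP : @lideal R (@ideal_mul R R^o (fun x => x \in J) P).
    exact: submod_ideal_mul.
  have [_] := lacc_lclosed acc lJP; apply=> u uJP; apply: Pp.
  apply: nmax => -[//|a q] [qn] /andP[Ja Jq].
  rewrite big_cons; apply: uJP.
  exact: (@mem_ideal_mul R R^o (fun x => x \in J) P a _ Ja (Pprod q qn Jq)).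
- by move=> a /jacobson_unit[u ua _]; exists u.
Qed.

Lemma acc_loewy : @lacc R \/ @racc R -> exists k, loewy k 1.
Proof. by case=> [/lacc_loewy|/racc_loewy]. Qed.
End SelfInjectiveCore.

(** * Simple subquotients and passage to the left chain condition *)

Section Artinian.
Variables (R : pzRingType) (injR : @rself_inj R).
Implicit Types (P B T m : R -> Prop) (x y : R).

Local Notation J := (@jacobson R).

(** The radical is nilpotent, so some multiple y' of y is outside P with y'J in P;
   it then generates a semisimple module modulo P. *)
Lemma simple_subquotient P y : @lacc R \/ @racc R -> rideal P -> ~ P y ->
  exists r m, [/\ rmax m, ~ P (y * r) & forall s, m s -> P (y * r * s)].
Proof.
move=> acc rP Py; have [k L1] := acc_loewy injR acc.
have [r Pyr PJ] : exists2 r, ~ P (y * r) & forall a, a \in J -> P (y * r * a).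
  apply: contrapT => nor.
  have step r : ~ P (y * r) -> exists2 a, a \in J & ~ P (y * (r * a)).
    move=> Pyr; apply: contrapT => noa; apply: nor; exists r => // a Ja.
    by apply: contrapT => Pa; apply: noa; exists a; rewrite // mulrA.
  have [s [sk Js Ps]] : exists s : seq R,
      [/\ size s = k, all [in J] s & ~ P (y * \prod_(a <- s) a)].
    elim: k {L1} => [|k [s [sk Js /step[a Ja Pa]]]].
      by exists [::]; split; rewrite ?big_nil ?mulr1.
    exists (rcons s a); split; rewrite ?size_rcons ?sk ?all_rcons ?Ja //.
    by rewrite big_rcons.
  apply: Ps; have := L1 s sk Js; rewrite mulr1 => ->; rewrite mulr0.
  exact: rideal0.
have rC : rideal (fun s => P (y * r * s)).
  split=> [|a b Pa Pb|b a Pa]; first by rewrite mulr0; apply: rideal0.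
    by rewrite mulrDr; apply: ridealD.
  by rewrite mulrA; apply: ridealM.
have [|m mm Cm] := rmax_exists rC; first by rewrite mulr1.
have [rm m1 _] := mm; have [g mg gP] := rideal_idem injR acc rm.
exists (r * (1 - g)), m; split=> // [Pg|s ms].
  apply: m1; rewrite -(subrK g 1); apply: ridealD => //.
  by apply: Cm; rewrite -mulrA.
by rewrite mulrA -mulrA mulrBl mul1r; apply/PJ/gP.
Qed.

(** Noetherian induction: if A is a largest right ideal below which descending
   chains stop, a simple submodule of R/A would enlarge it. *)
Lemma racc_rdcc : @racc R -> @rdcc R.
Proof.
move=> acc.
pose dccin P := forall C : nat -> R -> Prop, (forall n, rideal (C n)) ->
  (forall n x, C n.+1 x -> C n x) -> (forall x, C 0%N x -> P x) ->
  exists n, forall k x, C n x -> C (n + k)%N x.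
pose F P := rideal P /\ dccin P.
have F0 : F (fun x => x = 0).
  split; first by split=> [|x y -> ->|a x ->]; rewrite ?addr0 ?mul0r.
  by move=> C rC _ C0; exists 0%N => k x /C0->; apply: rideal0.
have FI P : F P -> rideal P by case.
have [A [rA dA] maxA] := racc_max acc FI F0.
have [A1|A1] := pselect (A 1).
  move=> C rC CS; have [|n nP] := dA C rC CS.
    by move=> x _; rewrite -[x]mul1r; apply: ridealM.
  by exists n => x /(nP 1%N); rewrite addn1.
have [r [m [[rm m1 mm] Ar mr]]] := simple_subquotient (or_intror acc) rA A1.
move: Ar mr; set x := 1 * r => Ax mx.
pose A' y := exists2 a, A a & exists s, y = a + x * s.
have rA' : rideal A'.
  split; first by exists 0; [apply: rideal0|exists 0; rewrite mulr0 addr0].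
    move=> _ _ [a Aa [s ->]] [b Ab [t ->]]; exists (a + b); first exact: ridealD.
    by exists (s + t); rewrite mulrDr addrACA.
  move=> c _ [a Aa [s ->]]; exists (a * c); first exact: ridealM.
  by exists (s * c); rewrite mulrDl mulrA.
case: Ax; apply: (maxA A'); last first.
- by exists 0; [apply: rideal0|exists 1; rewrite mulr1 add0r].
- by move=> a Aa; exists a => //; exists 0; rewrite mulr0 addr0.
split=> // C rC CS CA.
have Cle n k y : C (n + k)%N y -> C n y.
  by elim: k y => [|k IHk] y; rewrite ?addn0 // addnS => /CS/IHk.
have [n|n y [/CS]//|y []//|n nP] := dA (fun n y => C n y /\ A y).
  split; first by split; apply: rideal0.
    by move=> y z [? ?] [? ?]; split; apply: ridealD.
  by move=> a y [? ?]; split; apply: ridealM.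
have [[i Ci]|nC] := pselect (exists i, forall y, C i y -> A y).
  exists (n + i)%N => k y Cy; rewrite -addnA.
  have Ay : A y by apply: Ci; apply: (Cle i n); rewrite addnC.
  by have [] := nP (i + k)%N y (conj (Cle _ _ _ Cy) Ay).
exists n => k y Cy; have [z Cz Az] : exists2 z, C (n + k)%N z & ~ A z.
  apply: contrapT => noz; apply: nC; exists (n + k)%N => z Cz.
  by apply: contrapT => Az; apply: noz; exists z.
have A'in i u : C i u -> A' u by move=> Cu; apply/CA/(Cle 0%N i).
have [a Aa [s zE]] := A'in _ _ Cz; have [b Ab [t yE]] := A'in _ _ Cy.
have [|c [q [mc e1]]] := mm s.
  by move=> ms; apply: Az; rewrite zE; apply: ridealD => //; apply: mx.
have xE : x = z * q - a * q + x * c.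
  by rewrite zE mulrDl -mulrA [a * q + _]addrC addrK -mulrDr addrC -e1 mulr1.
have Ad : A (y - z * (q * t)).
  have -> : y - z * (q * t) = b + (x * c * t - a * q * t).
    rewrite yE {1}xE !mulrDl mulNr -addrA mulrA; congr (b + _).
    by rewrite addrC -addrA addKr addrC.
  apply: ridealD => //; apply: ridealB => //.
    by apply: ridealM => //; apply: mx.
  by rewrite -mulrA; apply: ridealM.
rewrite -(subrK (z * (q * t)) y); apply: ridealD => //; last exact: ridealM.
have [] // := nP k (y - z * (q * t)); split=> //; apply: ridealB => //.
by apply: ridealM => //; apply: Cle Cz.
Qed.

(** A left annihilator B with ann(B) minimal among those below a left ideal is that
   ideal, by lclosed_ladj. So all left ideals are annihilators, and ascending chains
   of them stop with the descending chains of their annihilators. *)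
Lemma rdcc_lacc : @rdcc R -> @lacc R.
Proof.
move=> dcc.
have closed B : lideal B -> lclosed B.
  move=> lB; pose F P := exists2 C, lclosed C /\ (forall y, C y -> B y) & P = annr C.
  have FI P : F P -> rideal P by move=> [C _ ->]; apply: rideal_annr.
  have F0 : F (annr (fun y => y = 0)).
    exists (fun y => y = 0) => //.
    by split=> [|y ->]; [apply: lclosed0|apply: lideal0].
  have [_ [C [cC CB] ->] minC] := rdcc_min dcc FI F0.
  suff -> : B = C by [].
  apply/funext=> b; apply/propext; split=> [Bb|/CB//].
  have annC := minC (annr (ladj C b)); apply: cC.2 => u Cu.
  apply: annC Cu _ (ladj_id b cC.1); last first.
    by move=> v Cv c Cc; apply: Cv; apply: ladj_sub.
  exists (ladj C b) => //; split; first exact: lclosed_ladj.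
  by move=> _ [c /CB Bc [r ->]]; apply: lidealD => //; apply: lidealM.
move=> N lN NS; have [n|n u Nu b /NS|n nP] := dcc (fun n => annr (N n)).
- exact: rideal_annr.
- exact: Nu.
exists n => x Nx; have [_] := closed _ (lN n); apply=> u /nP; exact.
Qed.

Lemma one_sided_lacc : @lacc R \/ @racc R -> @lacc R.
Proof. by case=> // /racc_rdcc/rdcc_lacc. Qed.

End Artinian.

(** * Simple right modules embed in R, and R is left self-injective *)

Section Kasch.
Variable R : pzRingType.
Implicit Types (P B I T U m : R -> Prop) (x y : R).

Local Notation J := (@jacobson R).

(** The map 1 -> y embeds R/m in R. *)
Definition rkasch : Prop :=
  forall m, rmax m -> exists2 y, y != 0 & forall r, m r -> y * r = 0.

(** Extend the map I + xR -> xR/(xR meet I) -> R/m, followed by an embedding of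
   R/m in R. *)
Lemma rideal_separate I x : @rself_inj R -> rkasch -> rideal I -> ~ I x ->
  exists2 c, forall a, I a -> c * a = 0 & c * x != 0.
Proof.
move=> injR kasch rI Ix.
have rC : rideal (fun r => I (x * r)).
  split=> [|r s Ir Is|a r Ir]; first by rewrite mulr0; apply: rideal0.
    by rewrite mulrDr; apply: ridealD.
  by rewrite mulrA; apply: ridealM.
have [|m mm Cm] := rmax_exists rC; first by rewrite mulr1.
have [y y0 ym] := kasch m mm.
have [||||c cP] := @rself_inj_graph R
  (fun u v => exists a r, [/\ I a, u = a + x * r & v = y * r]) injR.
- by exists 0, 0; rewrite !mulr0 addr0; split=> //; apply: rideal0.
- move=> _ _ _ _ [a [r [Ia -> ->]]] [b [s [Ib -> ->]]]; exists (a + b), (r + s).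
  by rewrite !mulrDr addrACA; split=> //; apply: ridealD.
- move=> t _ _ [a [r [Ia -> ->]]]; exists (a * t), (r * t).
  by rewrite mulrDl !mulrA; split=> //; apply: ridealM.
- move=> _ [a [r [Ia /esym e ->]]]; apply/ym/Cm.
  by rewrite -[x * r](addKr a) e addr0; apply: ridealN.
exists c => [a Ia|]; first by rewrite -(cP a 0) //; exists a, 0; rewrite !mulr0 addr0.
rewrite -(cP x y) //; exists 0, 1.
by rewrite !mulr1 add0r; split=> //; apply: rideal0.
Qed.

Definition ideal T : Prop := lideal T /\ rideal T.

Definition tmax T : Prop :=
  [/\ ideal T, ~ T 1 & forall T', ideal T' -> (forall x, T x -> T' x) ->
    ~ T' 1 -> forall x, T' x -> T x].

(** The annihilator of the simple right module R/m. *)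
Definition core m : R -> Prop := fun x => forall r, m (r * x).

Lemma ideal_sum T U : ideal T -> ideal U -> ideal (fun x => exists2 t, T t & U (x - t)).
Proof.
move=> [lT rT] [lU rU]; split; split.
- by exists 0; rewrite ?subr0; [apply: lideal0|apply: lideal0].
- move=> x y [t Tt Ut] [s Ts Us]; exists (t + s); first exact: lidealD.
  by rewrite opprD addrACA; apply: lidealD.
- move=> a x [t Tt Ut]; exists (a * t); first exact: lidealM.
  by rewrite -mulrBr; apply: lidealM.
- by exists 0; rewrite ?subr0; [apply: lideal0|apply: lideal0].
- move=> x y [t Tt Ut] [s Ts Us]; exists (t + s); first exact: lidealD.
  by rewrite opprD addrACA; apply: lidealD.
- move=> a x [t Tt Ut]; exists (t * a); first exact: ridealM.
  by rewrite -mulrBl; apply: ridealM.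
Qed.

Lemma tmax_comaximal T U : tmax T -> tmax U -> T <> U -> exists2 t, T t & U (1 - t).
Proof.
move=> [iT T1 mT] [iU U1 mU] neqTU; apply: contrapT => no.
have iV := ideal_sum iT iU; have [lT _] := iT; have [lU _] := iU.
have TV x : T x -> exists2 t, T t & U (x - t).
  by exists x => //; rewrite subrr; apply: lideal0.
have UV x : U x -> exists2 t, T t & U (x - t).
  by exists 0; [apply: lideal0|rewrite subr0].
apply: neqTU; apply/funext=> x; apply/propext; split=> [/TV|/UV].
  exact: (mU _ iV UV).
exact: (mT _ iV TV).
Qed.

Variable injR : @rself_inj R.

Lemma jacobson_sub_tmax T x : tmax T -> x \in J -> T x.
Proof.
move=> [[lT rT] T1 mT] Jx.
have iJ : ideal (fun x => x \in J) := conj (lideal_jacobson R) (rideal_jacobson R).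
apply: (mT _ (ideal_sum (conj lT rT) iJ)).
- by move=> t Tt; exists t => //; rewrite subrr rpred0.
- move=> [t Tt Jt]; apply: T1; have [u _ <-] := jacobson_unit injR Jt.
  by rewrite opprB addrCA subrr addr0; apply: ridealM.
- by exists 0; [apply: lideal0|rewrite subr0].
Qed.

Hypothesis acc : @lacc R.

(** The complementary idempotent of T in the semisimple ring R/J. *)
Lemma tmax_proper_annihilator T : tmax T ->
  exists2 e, e \notin J & forall t, T t -> t * e \in J.
Proof.
move=> mT; have [[lT rT] T1 _] := mT.
have [g Tg gP] := lideal_idem injR (or_introl acc) lT.
exists (1 - g) => [|t Tt]; last by rewrite mulrBr mulr1; apply: gP.
apply/negP=> Jg; apply: T1; rewrite -(subrK g 1); apply: lidealD => //.
exact: jacobson_sub_tmax.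
Qed.

(** The e of tmax_proper_annihilator is not in J = Z(R), so e is injective on some minimal right
   ideal w0 R; as J kills minimal right ideals, T kills w = e w0. *)
Lemma tmax_kills_simple T : tmax T -> exists w m,
  [/\ rmax m, w != 0, forall r, m r -> w * r = 0 & forall t, T t -> t * w = 0].
Proof.
move=> mT; have [e Je eT] := tmax_proper_annihilator mT.
have [x x0 xe] : exists2 x, x != 0 & forall r, x * r != 0 -> e * (x * r) != 0.
  apply: contrapT => nox; case/negP: Je; apply/(jacobson_rsing e injR) => x x0.
  apply: contrapT => nor; apply: nox; exists x => // r xr.
  by apply/eqP=> exr; apply: nor; exists r.
have r0 : rideal (fun y : R => y = 0).
  by split=> [|y z -> ->|a y ->]; rewrite ?addr0 ?mul0r.
have [|r [m [mm /eqP w0 w0m]]] := simple_subquotient injR (or_introl acc) r0 (y := x).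
  exact/eqP.
have [rm m1 mmm] := mm.
have Jw0 j : j \in J -> j * (x * r) = 0.
  move=> /(jacobson_rsing j injR)/(_ _ w0)[s w0s jw0s].
  have [|n [q [mn e1]]] := mmm s.
    by move=> /w0m e0; case/eqP: w0s.
  by rewrite -[x * r]mulr1 e1 mulrDr (w0m n) // add0r [_ * (s * q)]mulrA mulrA jw0s mul0r.
exists (e * (x * r)), m; split=> // [|s ms|t Tt].
- exact: xe.
- by rewrite -mulrA w0m ?mulr0.
- by rewrite mulrA Jw0 //; apply: eT.
Qed.

(** If an ideal T has an element outside core m, then 1 is in m + T. With T = Rf
   modulo J, this gives R(1 - f) <= m, whence 1 - f is in core m. *)
Lemma core_tmax m : rmax m -> tmax (core m).
Proof.
move=> mm; have [rm m1 mmm] := mm; split.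
- split; split.
  + by move=> r; rewrite mulr0; apply: rideal0.
  + by move=> x y mx my r; rewrite mulrDr; apply: ridealD.
  + by move=> a x mx r; rewrite mulrA; apply: mx.
  + by move=> r; rewrite mulr0; apply: rideal0.
  + by move=> x y mx my r; rewrite mulrDr; apply: ridealD.
  + by move=> a x mx r; rewrite mulrA; apply: ridealM.
- by move=> /(_ 1); rewrite mulr1.
move=> T [lT rT] mT T1 z Tz r; apply: contrapT => /mmm[n [s [mn e1]]].
have [f Tf fP] := lideal_idem injR (or_introl acc) lT.
apply: T1; rewrite -(subrK f 1); apply: lidealD => //; apply: mT => q.
have fJ x : T x -> x * (1 - f) \in J by move=> Tx; rewrite mulrBr mulr1; apply: fP.
set h := 1 - f in fJ *; rewrite -[q * h]mul1r e1 mulrDl; apply: ridealD => //.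
  exact: ridealM.
apply: jacobson_sub_rmax => //.
rewrite mulrA; apply: fJ.
by do 2!apply: ridealM => //; apply: lidealM.
Qed.

(** Modulo J one has m = gR, so left multiplication by any x = r(1 - g) maps R/m to
   R/m', and it is nonzero for some r because 1 - g is outside m, so
   outside core m, so outside core m'. *)
Lemma rmax_hom m m' : rmax m -> (forall x, core m' x -> core m x) ->
  exists2 x, ~ m' x & forall r, m r -> x * r \in J.
Proof.
move=> [rm m1 _] cm; have [g mg gP] := rideal_idem injR (or_introl acc) rm.
have [r nmr] : exists r, ~ m' (r * (1 - g)).
  apply: contrapT => /forallNP nor.
  have : core m (1 - g) by apply: cm => r; apply: contrapT; apply: nor.
  by move=> /(_ 1); rewrite mul1r => mg1; apply: m1; rewrite -(subrK g 1); apply: ridealD.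
exists (r * (1 - g)) => // s ms.
by rewrite -mulrA mulrBl mul1r; apply/jacobsonMl/gP.
Qed.

(** The minimal right ideal wR is isomorphic to R/m, so U is its right annihilator. *)
Definition kills_simple T U : Prop := exists w m,
  [/\ rmax m, w != 0, forall r, m r -> w * r = 0, forall t, T t -> t * w = 0 & U = core m].

Lemma rmax_annr w m r : rmax m -> w != 0 -> (forall s, m s -> w * s = 0) ->
  w * r = 0 -> m r.
Proof.
move=> [_ _ mm] /eqP w0 wm wr; apply: contrapT => /mm[n [s [mn e1]]]; apply: w0.
by rewrite -[w]mulr1 e1 mulrDr wm // mulrA wr mul0r addr0.
Qed.

(** If T1 kills w1 and T2 kills w2, where w1R and w2R are isomorphic, an isomorphism
   is left multiplication by some c, and both T1 and T2 kill c w1. *)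
Lemma kills_simple_inj T1 T2 U : tmax T1 -> tmax T2 ->
  kills_simple T1 U -> kills_simple T2 U -> T1 = T2.
Proof.
move=> mT1 mT2 [w1 [m1 [mm1 w10 wm1 Tw1 UE]]] [w2 [m2 [mm2 w20 wm2 Tw2 UE']]].
apply: contrapT => /(tmax_comaximal mT1 mT2)[t T1t T2t].
have [|x m2x xm] := @rmax_hom m1 m2 mm1; first by rewrite -UE -UE'.
have [[_ rT1] _ _] := mT1.
have [r w1r|d dE] := @rself_inj_dvd R w1 (w2 * x) injR.
  rewrite -mulrA wm2 //; apply: jacobson_sub_rmax => //; apply: xm.
  exact: rmax_annr w1r.
case: m2x; apply: (rmax_annr mm2 w20 wm2).
rewrite -[w2 * x]mul1r -(subrK t 1) mulrDl mulrA Tw2 // mul0r add0r dE mulrA Tw1 //.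
exact: ridealM.
Qed.

(** Sending T to the annihilator of a minimal right ideal killed by T is an injection
   on the maximal two-sided ideals, and it is onto: a
   maximal ideal outside the image would start an infinite sequence T0, T1, ... of
   distinct ones, and { x | (T0 /\ .. /\ Tn) x <= J } would increase strictly. *)
Lemma rself_inj_kasch : rkasch.
Proof.
move=> m mm; apply: contrapT => nom.
have nk T : tmax T -> ~ kills_simple T (core m).
  move=> mT [w [m' [mm' w0 wm' _ cE]]].
  have [|x m'x xm] := @rmax_hom m m' mm; first by rewrite cE.
  apply: nom; exists (w * x); first by apply/eqP=> /(rmax_annr mm' w0 wm').
  by move=> r mr; rewrite -mulrA wm' //; apply: jacobson_sub_rmax => //; apply: xm.
have [[T mT]|f f0 fS] := @dependent_choice {T | tmax T} (exist _ _ (core_tmax mm))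
    (fun S S' => kills_simple (sval S) (sval S')).
  have [w [m' [mm' w0 wm' wT]]] := tmax_kills_simple mT.
  by exists (exist _ _ (core_tmax mm')); exists w, m'.
have mf i : tmax (sval (f i)) := svalP (f i).
have dist i k : sval (f i) <> sval (f (i + k.+1)%N).
  elim: i => [|i IHi] fE.
    by apply: (nk _ (mf k)); have := fS k; rewrite -fE f0.
  apply: IHi; apply: kills_simple_inj (fS i) _ => //.
  by rewrite fE addSn; apply: fS.
pose I n x := forall y, (forall i, (i <= n)%N -> sval (f i) y) -> y * x \in J.
have [n|n x Inx y fy|n nP] := acc (N := I).
- split=> [y _|x z Ix Iz y fy|a x Ix y fy]; first by rewrite mulr0 rpred0.
    by rewrite mulrDr; apply: rpredD; [apply: Ix|apply: Iz].
  rewrite mulrA; apply: Ix => i le_in; have [[_ ri] _ _] := mf i.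
  by apply: ridealM => //; apply: fy.
- by apply: Inx => i le_in; apply: fy; apply: leqW.
have [e Je fe] := tmax_proper_annihilator (mf n.+1).
have Ie : I n e by apply: nP => y fy; apply: fe; apply: fy.
have [y fy y1] : exists2 y, (forall i, (i <= n)%N -> sval (f i) y) & sval (f n.+1) (1 - y).
  have [[lf rf] _ _] := mf n.+1.
  suff : forall k, (k < n.+1)%N ->
      exists2 y, (forall i, (i <= k)%N -> sval (f i) y) & sval (f n.+1) (1 - y).
    by apply.
  elim=> [_|k IHk lt_kn].
    have [|y fy y1] := tmax_comaximal (mf 0%N) (mf n.+1); first exact: (dist 0%N n).
    by exists y => // i; rewrite leqn0 => /eqP->.
  have [y fy y1] := IHk (ltnW lt_kn).
  have [|z fz z1] := tmax_comaximal (mf k.+1) (mf n.+1).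
    by have := dist k.+1 (n.+1 - k.+2)%N; rewrite addnS -addSn subnKC.
  exists (y * z) => [i|].
    rewrite leq_eqVlt => /predU1P[->|/fy fiy].
      by have [[li _] _ _] := mf k.+1; apply: lidealM.
    by have [[_ ri] _ _] := mf i; apply: ridealM.
  have -> : 1 - y * z = (1 - y) + y * (1 - z) by rewrite mulrBr mulr1 addrA subrK.
  by apply: lidealD => //; apply: lidealM.
case/negP: Je; rewrite -[e]mul1r -(subrK y 1) mulrDl; apply: rpredD.
  exact: fe.
exact: Ie.
Qed.

(** Let B in P be a largest left ideal on which f is right multiplication by some c,
   and b in P. As bR is a right annihilator, f b = b d; on the intersection of B and
   Rb the elements c and d act alike, so c - d is in ann(B) + ann(b), because this
   right ideal is a right annihilator. *)
Lemma rself_inj_lself_inj : @lself_inj R.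
Proof.
move=> P f lP fD fM.
have f0 : f 0 = 0 by rewrite -(mul0r 0) fM ?mul0r //; apply: lideal0.
pose F B := [/\ lideal B, forall x, B x -> P x & exists c, forall x, B x -> f x = x * c].
have FI B : F B -> lideal B by case.
have F0 : F (fun x => x = 0).
  split; [exact: (lclosed0 R).1|by move=> x ->; apply: lideal0|].
  by exists 0 => x ->; rewrite f0 mulr0.
have [B [lB BP [c cB]] maxB] := lacc_max acc FI F0.
exists c => x Px; suff Bx : B x by apply: cB.
apply: (maxB (ladj B x)); last exact: ladj_id; last first.
  by move=> y; apply: ladj_sub.
have rxR : rideal (fun y => exists r, y = x * r).
  split; first by exists 0; rewrite mulr0.
    by move=> _ _ [r ->] [s ->]; exists (r + s); rewrite mulrDr.
  by move=> a _ [r ->]; exists (r * a); rewrite mulrA.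
have [d fx] : exists d, f x = x * d.
  apply: contrapT => nod; have [z zx] := rideal_separate injR rself_inj_kasch rxR nod.
  by case/eqP; rewrite -fM // zx ?f0 //; exists 1; rewrite mulr1.
pose Rx y := exists r, y = r * x.
have lRx : lideal Rx.
  split; first by exists 0; rewrite mul0r.
    by move=> _ _ [r ->] [s ->]; exists (r + s); rewrite mulrDl.
  by move=> a _ [r ->]; exists (a * r); rewrite mulrA.
have rK := @submod_add R^c R^c^o _ _ (rideal_annr B) (rideal_annr Rx).
have [u Bu [v xv cdE]] : @sum_submod R^c R^c^o (annr B) (annr Rx) (c - d).
  apply: contrapT => nK.
  have [z zK] := rideal_separate injR rself_inj_kasch rK nK; case/eqP.
  have Bz : B z.
    apply: (lacc_lclosed injR acc lB).2 => y By; apply: zK.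
    by apply: sum_submodl By; apply: rideal_annr.
  have [r zE] : Rx z.
    apply: (lacc_lclosed injR acc lRx).2 => y xy; apply: zK.
    by apply: sum_submodr xy; apply: rideal_annr.
  by rewrite mulrBr -cB // {1}zE fM // fx mulrA -zE subrr.
split; [exact: lideal_ladj|by move=> _ [n /BP Pn [r ->]]; apply: lidealD => //; apply: lidealM|].
exists (c - u) => _ [n Bn [r ->]].
rewrite fD ?fM //; [|exact: BP|exact: lidealM].
rewrite fx cB // mulrDl [n * (_ - _)]mulrBr Bu // subr0; congr (_ + _).
have -> : c - u = v + d.
  by rewrite -(subrK d c) cdE -[u + v + d]addrA [u + _]addrC addrK.
rewrite mulrDr -[r * x * v]mulrA xv ?mulr0 ?add0r ?mulrA //.
by exists 1; rewrite mul1r.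
Qed.

End Kasch.

(** * Injective and projective modules over a ring *)

Section ModuleTools.
Variable A : pzRingType.

Lemma linear_of (U V : lmodType A) (g : U -> V) : linear g ->
  exists h : {linear U -> V}, forall x, h x = g x.
Proof.
move=> lg.
pose h := HB.pack_for {linear U -> V} g (GRing.isLinear.Build A U V *:%R g lg).
by exists h.
Qed.

Section SubmoduleType.
Variables (M : lmodType A) (N : submodClosed M).
Definition submod_type : Type := {x : M | x \in N}.
HB.instance Definition _ := SubType.on submod_type.
HB.instance Definition _ := [Choice of submod_type by <:].
HB.instance Definition _ := [SubChoice_isSubLmodule of submod_type by <:].
End SubmoduleType.

Lemma injective_module_lideal (E : lmodType A) (P : A -> Prop) (f : A -> E) :
  injective_module E -> lideal P ->
  (forall x y, P x -> P y -> f (x + y) = f x + f y) ->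
  (forall a x, P x -> f (a * x) = a *: f x) -> exists u, forall x, P x -> f x = x *: u.
Proof.
move=> injE lP fD fM; have [N NE] := @submod_closed_of A A^o P lP.
have NP (x : submod_type N) : P (\val x) by have := valP x; rewrite NE => /asboolP.
have [|h hE] := @linear_of (submod_type N) E (fun x => f (\val x)).
  move=> a x y; rewrite -[LHS]/(f (a * (\val x : A) + (\val y : A))).
  by rewrite fD ?fM //; apply: lidealM.
have [g gE] := injE _ _ (\val : {linear submod_type N -> A^o}) h val_inj.
exists (g 1) => x Px; have Nx : (x : A^o) \in N by rewrite NE; apply/asboolP.
have <- : g x = f x := etrans (gE (Sub (x : A^o) Nx)) (hE _).
by rewrite -{1}[x]mulr1; exact: (linearZZ g x (1 : A^o)).
Qed.

Lemma injective_module_lself_inj : injective_module A^o -> @lself_inj A.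
Proof. by move=> injA P f; apply: (@injective_module_lideal A^o). Qed.

(** Baer's criterion: a maximal functional graph extending f on i(M1) is total,
   since f extends over each cyclic submodule. *)
Lemma lself_inj_injective_module : @lself_inj A -> injective_module A^o.
Proof.
move=> injA M1 M2 i f i_inj.
have s0 : @submodule A (M2 * A^o)%type (fun p => exists x, p = (i x, f x)).
  split; first by exists 0; rewrite !linear0.
    by move=> _ _ [x ->] [y ->]; exists (x + y); rewrite !linearD.
  by move=> a _ [x ->]; exists (a *: x); rewrite !linearZ.
have [|G [sG fG badG maxG]] := zorn_avoid (bad := fun p => p.1 = 0 /\ p.2 <> 0) s0.
  move=> _ [x ->] /= [ix0]; apply.
  by have -> : x = 0; [apply: i_inj; rewrite ix0 linear0|rewrite linear0].
have Gfun x u v : G (x, u) -> G (x, v) -> u = v.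
  move=> Gu Gv; apply/eqP; rewrite -subr_eq0; apply/eqP; apply: contrapT => uv.
  have /badG := submodB sG Gu Gv; apply; split=> //=; exact: subrr.
have /choice[h hP] (x : M2) : exists u, G (x, u).
  have /choice[k kP] a : exists u, (exists v, G (a *: x, v)) -> G (a *: x, u).
    have [[v Gv]|nG] := pselect (exists v, G (a *: x, v)); first by exists v.
    by exists 0.
  have GS (a b : A) u v : G (a *: x, u) -> G (b *: x, v) -> G ((a + b) *: x, u + v).
    by move=> Gu Gv; rewrite scalerDl; apply: submodD sG Gu Gv.
  have GZ (a b : A) u : G (a *: x, u) -> G ((b * a) *: x, b *: u).
    by move=> Gu; rewrite -scalerA; apply: (submodZ b sG Gu).
  have [|a b [u Gu] [v Gv]|b a [u Gu]|b bP] :=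
      injA (fun a => exists u, G (a *: x, u)) k.
  - split; first by exists 0; rewrite scale0r; apply: submod0 sG.
      by move=> a b [u Gu] [v Gv]; exists (u + v); apply: GS.
    by move=> b a [u Gu]; exists (b *: u); apply: GZ.
  - apply: (Gfun ((a + b) *: x)); first by apply: kP; exists (u + v); apply: GS.
    by apply: GS; apply: kP; [exists u|exists v].
  - apply: (Gfun ((b * a) *: x)); first by apply: kP; exists (b *: u); apply: GZ.
    by apply: GZ; apply: kP; exists u.
  exists b; apply: contrapT => /maxG[[y u] [a [Gyu /= [yx ub]]]]; apply: ub.
  have Gax : G (a *: x, - u).
    have -> : (a *: x, - u) = - (y, u) by congr pair; apply/eqP; rewrite -addr_eq0 addrC yx.
    exact: submodN.
  have := bP a (ex_intro _ _ Gax).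
  rewrite (Gfun _ _ _ (kP a (ex_intro _ _ Gax)) Gax) => bE.
  by rewrite -[_ *: _]/(a * b) -bE subrr.
have [|g gE] := @linear_of M2 A^o h.
  move=> a x y; apply: (Gfun (a *: x + y)) => //.
  exact: (submodD sG (submodZ a sG (hP x)) (hP y)).
exists g => x; rewrite gE; apply: (Gfun (i x)) => //.
by apply: fG; exists x.
Qed.

Lemma noetherian_module_lacc : noetherian_module A^o -> @lacc A.
Proof.
move=> noeth N lN NS.
have /choice[N' N'E] n := @submod_closed_of A A^o (N n) (lN n).
have [n x|n nP] := noeth N'.
  by rewrite !N'E => /asboolP Nx; apply/asboolP/NS.
exists n => x Nx; have := nP n.+1 (leqnSn n) x; rewrite !N'E.
by move/asboolP: (Nx) => -> /esym/asboolP.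
Qed.

Lemma projective_regular : projective_module A^o.
Proof.
move=> M1 M2 p f psurj; have [y yE] := psurj (f 1).
have [|g gE] := @linear_of A^o M1 (fun a : A => a *: y).
  by move=> a x z; rewrite scalerDl scalerA.
exists g => x; rewrite gE linearZ /= yE -linearZ /=.
by congr (f _); rewrite -[LHS]/((x : A) * 1) mulr1.
Qed.

Lemma projective_max_projective (M : lmodType A) :
  projective_module M -> max_projective_module M.
Proof.
move=> projM I _ f.
have [|g gE] := projM _ _ (@quotm_pi A A^o I : {linear _ -> _}) f.
  exact: quotm_pi_surj.
by exists g => x; rewrite -gE.
Qed.

Lemma injective_hull_self : injective_module A^o ->
  @injective_hull A A^o A^o (idfun : {linear A^o -> A^o}).
Proof. by move=> injA; split=> // N [y Ny y0]; exists y. Qed.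

End ModuleTools.

Lemma simple_module_cyclic (A : pzRingType) (S : lmodType A) : simple_module S ->
  exists N : submodClosed A^o, isomorphic S (quotm N).
Proof.
move=> [[s s0] simS].
have sN : @submodule A A^o (fun a => (a : A) *: s = 0).
  split=> [|x y xs ys|a x xs]; first by rewrite scale0r.
    by rewrite scalerDl xs ys addr0.
  by rewrite -scalerA xs scaler0.
have [N NE] := submod_closed_of sN; exists N.
have [K KE] := submod_closed_of (submod_cyclic s).
have /choice[c cP] (x : S) : exists a : A, x = a *: s.
  have [K0|/(_ x)] := simS K; last by rewrite KE => /asboolP.
  by case/eqP: s0; apply: K0; rewrite KE; apply/asboolP/cyclic_id.
have piE (a b : A^o) : quotm_pi N a = quotm_pi N b <-> (a : A) *: s = (b : A) *: s.
  split=> [/eqP|ab]; last first.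
    by apply/eqP; rewrite quotm_piE NE; apply/asboolP; rewrite scalerBl ab subrr.
  by rewrite quotm_piE NE => /asboolP; rewrite scalerBl => /eqP; rewrite subr_eq0 => /eqP.
have [|h hE] := @linear_of A S (quotm N) (fun x => quotm_pi N (c x : A^o)).
  by move=> a x y; rewrite -linearP; apply/piE; rewrite -cP scalerDl -scalerA -!cP.
exists h; pose g (u : quotm N) : S := (repr (u : {ideal_quot submod_pred N}) : A) *: s.
have gE (a : A^o) : g (quotm_pi N a) = (a : A) *: s.
  by apply/piE; rewrite /quotm_pi reprK.
exists g => [x|u]; first by rewrite hE gE -cP.
by have [a <-] := quotm_pi_surj u; rewrite gE hE; apply/piE; rewrite -cP.
Qed.

(** Every simple module is a factor of R, which is itself injective. *)
Lemma rself_inj_dual_kasch (R : pzRingType) :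
  right_self_injective R -> right_dual_kasch R.
Proof.
by move=> injR S /simple_module_cyclic[N SN]; exists R^c^o, N.
Qed.

(** * Semilocality *)

Section Semilocal.
Variable R : pzRingType.
Hypotheses (injR : @rself_inj R) (acc : @lacc R).

(** A right ideal N of R/J is gR/J with g idempotent, and { q | gq = 0 } complements
   it. Descending chains of right ideals stop because the left ideals
   { x | xN <= J } ascend and determine N, as 1 - g lies in this ideal. *)
Lemma rself_inj_semilocal : semilocal R.
Proof.
pose Q := quot_jacobson R.
pose pre (N : submodClosed Q^c^o) (x : R) : Prop := (qjac_pi x : Q^c^o) \in N.
have rpre N : rideal (pre N).
  split=> [|x y Nx Ny|a x Nx]; rewrite /pre.
  - by rewrite raddf0; apply: rpred0.
  - by rewrite raddfD; apply: (rpredD Nx Ny).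
  - by rewrite quot_piM; apply: (@rpredZ _ _ N (qjac_pi a : Q^c) _ Nx).
have gen N := rideal_idem injR (or_introl acc) (rpre N).
have piM g x : x - g * x \in @jacobson R -> qjac_pi x = qjac_pi g * qjac_pi x.
  by rewrite -qjac_piE quot_piM => /eqP.
split=> [N|N NS].
  have [g Ng gP] := gen N.
  have sK : @submodule Q^c Q^c^o (fun q => qjac_pi g * (q : Q) = 0).
    split=> [|x y xK yK|a x xK]; first by rewrite mulr0.
      by rewrite -[LHS]/(qjac_pi g * ((x : Q) + (y : Q))) mulrDr xK yK addr0.
    by rewrite -[LHS]/(qjac_pi g * ((x : Q) * (a : Q))) mulrA xK mul0r.
  have [K KE] := submod_closed_of sK; exists K; split=> [x Nx|x].
    rewrite KE => /asboolP; have [y yE] := qjac_pi_surj (x : Q).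
    by rewrite -yE => <-; apply/piM/gP; rewrite /pre yE.
  have [y yE] := qjac_pi_surj (x : Q).
  exists (qjac_pi (g * y)), (qjac_pi (y - g * y)); split.
  - exact: ridealM (rpre N) Ng.
  - rewrite KE; apply/asboolP; rewrite -quot_piM mulrBr raddfB /= [g * (g * y)]mulrA.
    by rewrite !quot_piM -(piM _ _ (gP g Ng)) subrr.
  - by rewrite -raddfD /= addrC subrK yE.
pose L n x := forall y, pre (N n) y -> x * y \in @jacobson R.
have [n|n x Lx y Ny|n nP] := lacc_stable (N := L) acc.
- split=> [y _|x z Lx Lz y Ny|a x Lx y Ny]; first by rewrite mul0r rpred0.
    by rewrite mulrDl; apply: rpredD; [apply: Lx|apply: Lz].
  by rewrite -mulrA; apply/jacobsonMl/Lx.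
- exact/Lx/NS.
exists n => m le_nm q; apply/idP/idP => [|Nq].
  by move: le_nm => /subnK<-; elim: (m - n)%N => // k IHk /NS/IHk.
have [g Ng gP] := gen (N m); have [y yE] := qjac_pi_surj (q : Q).
have Lg : L n (1 - g).
  by apply: (nP m le_nm) => z /gP; rewrite mulrBl mul1r.
have := Lg y; rewrite /pre yE mulrBl mul1r => /(_ Nq)/piM; rewrite -quot_piM yE => ->.
exact: (ridealM y (rpre (N m)) Ng).
Qed.

End Semilocal.

(** * Rings with a max-projective injective hull *)

Section MaxProjective.
Variable A : pzRingType.

(** The t such that f(x) t = x b is solvable for every partial homomorphism f form a
   left ideal; it contains the values of all g : E -> A, since x -> f(x) e extends to
   A by injectivity of E. Lifting nonzero maps E -> A/I shows that no maximal left
   ideal contains all these values, so t = 1 is one of them. *)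
Lemma max_projective_lself_inj (E : lmodType A) :
  injective_module E -> max_projective_module E ->
  (forall I : submodClosed A^o, maximal_submod I ->
    exists (f : {linear E -> quotm I}) e, f e != 0) -> @lself_inj A.
Proof.
move=> injE projE simE.
pose T t := forall (P : A -> Prop) (f : A -> A), lideal P ->
  (forall x y, P x -> P y -> f (x + y) = f x + f y) ->
  (forall a x, P x -> f (a * x) = a * f x) ->
  exists b, forall x, P x -> f x * t = x * b.
have lT : lideal T.
  split=> [P f _ _ _|t u Tt Tu P f lP fD fM|r t Tt P f lP fD fM].
  - by exists 0 => x _; rewrite !mulr0.
  - have [b bP] := Tt P f lP fD fM; have [c cP] := Tu P f lP fD fM.
    by exists (b + c) => x Px; rewrite !mulrDr bP ?cP.
  - have [|a x Px|b bP] := Tt P (fun x => f x * r) lP.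
    + by move=> x y Px Py; rewrite fD // mulrDl.
    + by rewrite fM // mulrA.
    by exists b => x Px; rewrite mulrA bP.
have Tg (g : {linear E -> A^o}) e : T (g e).
  move=> P f lP fD fM.
  have [|a x Px|u uP] := @injective_module_lideal A E P (fun x => f x *: e) injE lP.
  - by move=> x y Px Py; rewrite fD // scalerDl.
  - by rewrite fM // scalerA.
  exists (g u) => x Px.
  by rewrite -[LHS]/(f x *: (g e)) -[RHS]/(x *: (g u)) -!linearZZ uP.
suff T1 : T 1.
  move=> P f lP fD fM; have [b bP] := T1 P f lP fD fM.
  by exists b => x Px; rewrite -bP ?mulr1.
apply: contrapT => T1; have [m mm Tm] := lmax_exists lT T1.
have [I mI IE] := lmax_maximal_submod mm.
have [f [e fe]] := simE I mI; have [g gE] := projE I mI f.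
case/eqP: fe; rewrite gE -(linear0 (@quotm_pi A A^o I)); apply/eqP.
by rewrite quotm_piE subr0 IE; apply/asboolP/Tm/Tg.
Qed.

Lemma simple_module_quotm (I : submodClosed A^o) : maximal_submod I -> simple_module (quotm I).
Proof.
move=> [[x xI] mI]; split.
  exists (quotm_pi I x); rewrite -(linear0 (@quotm_pi A A^o I)) quotm_piE subr0 //.
move=> N; have sN : @submodule A A^o (fun y => quotm_pi I y \in N).
  split=> [|y z Ny Nz|a y Ny]; rewrite ?linear0 ?linearD ?linearZ /=.
  - exact: rpred0.
  - exact: rpredD.
  - exact: rpredZ.
have [K KE] := submod_closed_of sN.
have [y Iy|KI|Kall] := mI K.
- rewrite KE; apply/asboolP; suff -> : quotm_pi I y = 0 by apply: rpred0.
  by apply/eqP; rewrite -(linear0 (@quotm_pi A A^o I)) quotm_piE subr0.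
- left=> u; have [y <-] := quotm_pi_surj u => Ny.
  apply/eqP; rewrite -(linear0 (@quotm_pi A A^o I)) quotm_piE subr0 -KI KE.
  exact/asboolP.
by right=> u; have [y <-] := quotm_pi_surj u; have := Kall y; rewrite KE => /asboolP.
Qed.

(** A simple factor of some injective module is a factor of E: a preimage of a nonzero
   element is hit by a map A -> E', which extends to E. *)
Lemma injective_hull_simple_quotient (S E E' : lmodType A) (i : {linear A^o -> E})
    (N : submodClosed E') : injective i -> simple_module S -> injective_module E' ->
  isomorphic S (quotm N) -> exists (f : {linear E -> S}) e, f e != 0.
Proof.
move=> i_inj [[s s0] _] injE' [h [h' hK h'K]].
have [x xE] := quotm_pi_surj (h s).
have [|k kE] := @linear_of A A^o E' (fun a : A => a *: x).
  by move=> a b c; rewrite scalerDl scalerA.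
have [g gE] := injE' _ _ i k i_inj.
have h'lin : linear h'.
  by move=> a u v; apply: (can_inj hK); rewrite linearP !h'K.
have [|f fE] := @linear_of A E S (fun e => h' (quotm_pi N (g e))).
  by move=> a u v; rewrite !linearP h'lin.
exists f, (i 1); rewrite fE gE kE scale1r xE hK; exact: s0.
Qed.

End MaxProjective.

Section DualKasch.
Variable R : pzRingType.

Lemma dual_kasch_self_injective : right_dual_kasch R -> ER_max_projective R ->
  right_self_injective R.
Proof.
move=> kasch [E [i [[injE i_inj _] projE]]].
apply: (@lself_inj_injective_module R^c).
apply: (max_projective_lself_inj injE projE) => I /simple_module_quotm sI.
have [E' [N [injE' SN]]] := kasch _ sI.
exact: (injective_hull_simple_quotient i_inj sI injE' SN).
Qed.

End DualKasch.

(** The left-right symmetry of quasi-Frobenius rings: when R is left self-injective,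
   rself_inj_lself_inj applies to the converse ring. *)
Lemma quasi_frobenius_lacc_rself_inj (R : pzRingType) : quasi_frobenius R ->
  @lacc R /\ @rself_inj R.
Proof.
move=> [noeth inj].
have acc : @lacc R \/ @racc R.
  by case: noeth => /noetherian_module_lacc; [left|right].
case: inj => /injective_module_lself_inj inj; last first.
  have injR : @rself_inj R := inj.
  by split=> //; apply: one_sided_lacc.
have injR : @rself_inj R^c := inj.
have raccR : @racc R.
  by apply: (one_sided_lacc injR); case: acc; [right|left].
have rinj : @rself_inj R := @rself_inj_lself_inj R^c injR raccR.
by split=> //; apply: one_sided_lacc rinj _; right.
Qed.

Lemma rself_inj_module (R : pzRingType) : @rself_inj R -> right_self_injective R.
Proof. exact: (@lself_inj_injective_module R^c). Qed.

(** * Free modules and the filtration by powers of an ideal *)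

Section Free.
Variable A : nzRingType.

Lemma fglift_linear (M : lmodType A) (K : choiceType) (f : K -> M) :
  linear (@fglift A M K f).
Proof.
have fgU (k : A) (x : K) : @fglift A M K f << k *g x >> = k *: f x by exact: liftU.
move=> a c d; have addf := @lift_is_additive A K M f.
have fD u v : fglift f (u + v) = fglift f u + fglift f v.
  have f0 : fglift f 0 = 0 by rewrite -(subrr 0) addf subrr.
  have fN w : fglift f (- w) = - fglift f w by rewrite -sub0r addf f0 sub0r.
  by rewrite -[v in LHS]opprK addf fN opprK.
rewrite fD; congr (_ + _); rewrite -[in LHS](freeg_sumE c) -[in RHS](freeg_sumE c).
have fS (r : seq K) (F : K -> {freeg K / A}) :
    fglift f (\sum_(z <- r) F z) = \sum_(z <- r) fglift f (F z).
  elim: r => [|z r IHr]; last by rewrite !big_cons fD IHr.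
  by rewrite !big_nil -(subrr 0) addf subrr.
rewrite scaler_sumr !fS scaler_sumr; apply: eq_bigr => z _.
have -> : a *: << coeff z c *g z >> = << a * coeff z c *g z >> :> {freeg K / A}.
  by apply/eqP/freeg_eqP=> x; rewrite coeffZ !coeffU mulrA.
by rewrite !fgU scalerA.
Qed.

Lemma free_lift (M : lmodType A) (K : choiceType) (f : K -> M) :
  exists h : {linear {freeg K / A} -> M}, forall x, h << x >> = f x.
Proof.
have [h hE] := linear_of (fglift_linear f); exists h => x.
by rewrite hE liftU scale1r.
Qed.

Lemma free_ind (K : choiceType) (P : {freeg K / A} -> Prop) :
  submodule P -> (forall x, P << x >>) -> forall c, P c.
Proof.
move=> sP Pgen c; rewrite -[c]freeg_sumE; apply: submod_sum => // z.
have -> : << coeff z c *g z >> = coeff z c *: << z >> :> {freeg K / A}.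
  by apply/eqP/freeg_eqP=> x; rewrite coeffZ !coeffU mul1r.
exact: submodZ.
Qed.

Lemma free_linear_eq (K : choiceType) (M : lmodType A) (f g : {linear {freeg K / A} -> M}) :
  (forall x, f << x >> = g << x >>) -> forall c, f c = g c.
Proof.
move=> fg; apply: free_ind => //; split=> [|x y fgx fgy|a x fgx]; first by rewrite !linear0.
  by rewrite !linearD fgx fgy.
by rewrite !linearZ /= fgx.
Qed.

End Free.

Section Filtration.
Variables (A : pzRingType) (J : A -> Prop) (M : lmodType A).

(** The submodule J^k M. *)
Fixpoint ideal_pow k : M -> Prop :=
  if k is k'.+1 then ideal_mul J (ideal_pow k') else fun=> True.

Lemma submod_ideal_pow k : submodule (ideal_pow k).
Proof. by case: k => [|k]; [split|apply: submod_ideal_mul]. Qed.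

Lemma ideal_pow_shift (f : {linear M -> M}) k :
  (forall x, ideal_pow 1 (f x)) -> forall x, ideal_pow k x -> ideal_pow k.+1 (f x).
Proof.
move=> f1; elim: k => [|k IHk] x; first by move=> _; apply: f1.
move=> Jx; apply: (Jx (fun x => ideal_pow k.+2 (f x))) => [|a n Ja Jn].
  have sJ := submod_ideal_pow k.+2.
  split=> [|y z Jy Jz|a y Jy]; rewrite ?linear0 ?linearD ?linearZ.
  - exact: submod0 sJ.
  - exact: submodD sJ Jy Jz.
  - exact: (submodZ a sJ Jy).
by rewrite linearZ; apply: mem_ideal_mul => //; apply: IHk.
Qed.

(** J^k M is killed by all products of n - k elements of J, by induction on k. *)
Lemma nilpotent_ideal_pow n : rideal J ->
  (forall s : seq A, size s = n -> (forall a, a \in s -> J a) -> \prod_(a <- s) a = 0) ->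
  forall x, ideal_pow n x -> x = 0.
Proof.
move=> rJ nilJ x nx.
pose kills j (y : M) := forall s : seq A, size s = j -> (forall a, a \in s -> J a) ->
  (\prod_(a <- s) a) *: y = 0.
have sub_kills j : submodule (kills j).
  split=> [s _ _|u v ku kv s sj sJ|a u ku s sj sJ]; first by rewrite scaler0.
    by rewrite scalerDr ku // kv // addr0.
  case: (lastP s) sj sJ => [|t b] => [j0 _|].
    by have := ku [::] j0; rewrite big_nil !scale1r => ->; rewrite ?scaler0.
  rewrite size_rcons => tj tJ; rewrite big_rcons -scalerA [b *: _]scalerA scalerA -big_rcons.
  apply: ku; rewrite ?size_rcons // => c; rewrite mem_rcons inE => /predU1P[->|ct].
    by apply: ridealM => //; apply: tJ; rewrite mem_rcons mem_head.
  by apply: tJ; rewrite mem_rcons inE ct orbT.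
suff H k j y : (k + j)%N = n -> ideal_pow k y -> kills j y.
  by have := H n 0%N x (addn0 n) nx [::] erefl; rewrite big_nil scale1r; apply.
elim: k j y => [|k IHk] j y.
  by rewrite add0n => -> _ s sn sJ; rewrite nilJ // scale0r.
move=> kjn; apply=> // a u Ja Ju s sj sJ; rewrite scalerA -big_rcons.
apply: (IHk j.+1) => //; first by rewrite addnS -addSn.
  by rewrite size_rcons sj.
by move=> b; rewrite mem_rcons inE => /predU1P[->//|/sJ].
Qed.

(** A submodule L with L + JM = M satisfies L + J^k M = M for all k. *)
Lemma nilpotent_superfluous (L : M -> Prop) n : (forall x, ideal_pow n x -> x = 0) ->
  submodule L -> (forall x, sum_submod L (ideal_pow 1) x) -> forall x, L x.
Proof.
move=> nilM sL LJ x.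
suff /(_ n x)[y Ly [z /nilM-> ->]] : forall k y, sum_submod L (ideal_pow k) y.
  by rewrite addr0.
elim=> [|k IHk] {}x; first by apply: sum_submodr.
have [y Ly [z Jz ->]] := IHk x.
suff [y' Ly' [z' Jz' ->]] : sum_submod L (ideal_pow k.+1) z.
  exists (y + y'); first exact: submodD.
  by exists z'; rewrite ?addrA.
elim: k {IHk x y Ly} z Jz => [|k IHk] z Jz; first exact: LJ.
have sS := submod_add sL (submod_ideal_pow k.+2).
apply: Jz => // a u Ja Ju; have [l Ll [w Jw ->]] := IHk u Ju.
rewrite scalerDr; apply: (submodD sS).
  by apply: sum_submodl; [apply: submod_ideal_pow|apply: submodZ].
by apply: sum_submodr => //; apply: mem_ideal_mul.
Qed.

End Filtration.

(** * Projective covers over semiprimary rings *)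

Section IdempotentLifting.
Variables (A : pzRingType) (J : A -> Prop) (F : lmodType A).

(** One step of the lifting phi -> 3 phi^2 - 2 phi^3, written phi^2 (1 + 2 (1 - phi));
   symmetrically 1 - psi = (1 - phi)^2 (1 + 2 phi), so psi - psi^2 is a multiple of
   (phi - phi^2)^2. *)
Lemma lift_idempotent_step (N K : F -> Prop) (f : {linear F -> F}) k :
  submodule N -> submodule K -> (0 < k)%N ->
  (forall c, N (f c)) -> (forall c, K (c - f c)) ->
  (forall c, ideal_pow J k (f c - f (f c))) ->
  exists g : {linear F -> F}, [/\ forall c, N (g c), forall c, K (c - g c) &
    forall c, ideal_pow J k.+1 (g c - g (g c))].
Proof.
move=> sN sK k0 fN fK fJ; have [d dE] : exists d : F -> F, forall c, d c = c - f c by exists (fun c => c - f c).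
have dD x y : d (x + y) = d x + d y by rewrite !dE linearD opprD addrACA.
have dZ a x : d (a *: x) = a *: d x by rewrite !dE linearZ scalerBr.
have fd x : f (d x) = d (f x) by rewrite !dE linearB.
have fdK x : f x + d x = x by rewrite dE addrC subrK.
have [|g gE] := @linear_of A F F (fun c => f (f (c + d c + d c))).
  move=> a x y; rewrite -!linearP; congr (f (f _)).
  by rewrite dD dZ !scalerDr [a *: x + y + _]addrACA [LHS]addrACA.
have gdE c : c - g c = d (d (c + f c + f c)).
  have cE : c = (f (f c) + f (d c)) + (f (d c) + d (d c)).
    by rewrite [f (d c) + d _]fdK fd fdK fdK.
  have Y2 : f (d (d c)) + f (f (d c)) = f (d c) by rewrite -linearD addrC fdK.
  apply/eqP; rewrite subr_eq gE !(dD, linearD) -!fd; apply/eqP.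
  rewrite addrACA [d (d c) + _ + _]addrACA Y2 [LHS]cE.
  by rewrite [f (d c) + d _]addrC addrACA addrA [_ + d (d c)]addrC.
have [|nu nuE] := @linear_of A F F (fun c => f (d c)).
  by move=> a x y; rewrite dD dZ linearP.
have nuJ c : ideal_pow J k (nu c) by rewrite nuE dE linearB.
exists g; split=> c.
- by rewrite gE.
- by rewrite gdE dE; apply: fK.
have -> : g c - g (g c) = nu (nu (let e := c + f c + f c in e + d e + d e)).
  rewrite -linearB gdE gE !nuE /=; set e := c + f c + f c.
  by rewrite -!dD -fd.
apply: ideal_pow_shift => // x; case: k k0 nuJ {fJ} => // k _ nuJ K' sK' KJ.
by apply: (nuJ x) => // a n Ja _; apply: KJ.
Qed.

End IdempotentLifting.

Section ProjectiveCovers.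
Variables (A : nzRingType) (J : A -> Prop) (n : nat).
Hypotheses (lJ : lideal J) (rJ : rideal J).
Hypothesis nilJ : forall s : seq A, size s = n -> (forall a, a \in s -> J a) ->
  \prod_(a <- s) a = 0.
Hypothesis idemJ : forall P : A -> Prop, lideal P ->
  exists2 g, P g & forall x, P x -> J (x - x * g).

(** F/JF is semisimple: a maximal N over JF meeting K inside JF complements K. For
   x outside N + K, the annihilator of x modulo N + K lies in a maximal left ideal
   m = Ag + J, so y = (1 - g) x is outside N + K with my in JF, and N + Ay still
   meets K inside JF. *)
Lemma semisimple_complement (F : lmodType A) (K : F -> Prop) : submodule K ->
  exists N, [/\ submodule N, forall x, ideal_pow J 1 x -> N x,
    forall x, N x -> K x -> ideal_pow J 1 x & forall x, sum_submod N K x].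
Proof.
move=> sK; have sJ := @submod_ideal_pow A J F 1.
have [|N [sN JN badN maxN]] := zorn_avoid (bad := fun z => K z /\ ~ ideal_pow J 1 z) sJ.
  by move=> x Jx [].
have NKJ x : N x -> K x -> ideal_pow J 1 x.
  by move=> Nx Kx; apply: contrapT => Jx; apply: (badN x).
exists N; split=> // x; apply: contrapT => NKx.
have sNK := submod_add sN sK.
have sC : lideal (fun r => sum_submod N K (r *: x)).
  split=> [|a b Ca Cb|a b Cb]; first by rewrite scale0r; apply: submod0 sNK.
    by rewrite scalerDl; apply: submodD sNK Ca Cb.
  by rewrite -scalerA; apply: (submodZ a sNK Cb).
have [|m [lm m1 mm] Cm] := lmax_exists sC; first by rewrite scale1r.
have [g mg gP] := idemJ lm.
pose y := (1 - g) *: x.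
have my r : m r -> ideal_pow J 1 (r *: y).
  move=> mr; rewrite /y scalerA mulrBr mulr1.
  by apply: mem_ideal_mul => //; apply: gP.
have NKy : ~ sum_submod N K y.
  by move=> /Cm m1g; apply: m1; rewrite -(subrK g 1); apply: lidealD.
have [|z [r [Nz [Kzr Jzr]]]] := maxN y.
  by move=> Ny; apply: NKy; apply: sum_submodl.
have [mr|/mm[s [t [ms e1]]]] := pselect (m r).
  by apply: Jzr; apply: NKJ => //; apply: (submodD sN Nz (JN _ (my r mr))).
apply: NKy; rewrite -[y]scale1r e1 scalerDl -scalerA; apply: (submodD sNK).
  by apply: sum_submodl => //; apply: (JN _ (my s ms)).
apply: (submodZ t sNK); exists (- z); first exact: submodN.
by exists (z + r *: y); rewrite ?addKr.
Qed.

Lemma lift_idempotent (F : lmodType A) (N K : F -> Prop) (f : {linear F -> F}) :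
  submodule N -> submodule K ->
  (forall c, N (f c)) -> (forall c, K (c - f c)) ->
  (forall c, ideal_pow J 1 (f c - f (f c))) ->
  exists e : {linear F -> F}, [/\ forall c, N (e c), forall c, K (c - e c) &
    forall c, e (e c) = e c].
Proof.
move=> sN sK fN fK fJ.
have [g [gN gK gJ]] : exists g : {linear F -> F}, [/\ forall c, N (g c),
    forall c, K (c - g c) & forall c, ideal_pow J n.+1 (g c - g (g c))].
  elim: n => [|k [g [gN gK gJ]]]; first by exists f.
  exact: lift_idempotent_step gJ.
exists g; split=> // c; symmetry; apply/eqP; rewrite -subr_eq0; apply/eqP.
apply: (gJ c (fun x => x = 0) (submod_zero F)).
by move=> a x _ /(nilpotent_ideal_pow rJ nilJ)->; rewrite scaler0.
Qed.

(** Let F be free on the set M and K the kernel of F -> M. Lifting the idempotent of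
   F/JF that projects onto a complement of K gives e with F = eF + K; then eF -> M
   is a projective cover, its kernel being inside J(eF). *)
Lemma semiprimary_projective_cover (M : lmodType A) :
  exists (P : lmodType A) (p : {linear P -> M}), projective_cover p.
Proof.
pose F : lmodType A := {freeg M / A}.
have [q qE] := @free_lift A M M id.
pose K (c : F) := q c = 0.
have sK : submodule K.
  split=> [|c d Kc Kd|a c Kc]; rewrite /K ?linear0 ?linearD ?linearZ //=.
    by rewrite Kc Kd addr0.
  by rewrite Kc scaler0.
have [N [sN JN NKJ NK]] := semisimple_complement sK.
have /choice[b bP] (x : M) : exists v : F, N v /\ K (<< x >> - v).
  by have [v Nv [k Kk ->]] := NK << x >>; exists v; rewrite addrC addKr.
have [f fE] := free_lift b.
have fN c : N (f c).
  move: c; apply: free_ind => [|x]; last by rewrite fE; have [] := bP x.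
  split=> [|x y Nx Ny|a x Nx]; rewrite ?linear0 ?linearD ?linearZ.
  - exact: submod0 sN.
  - exact: submodD sN Nx Ny.
  - exact: (submodZ a sN Nx).
have fK c : K (c - f c).
  move: c; apply: free_ind => [|x]; last by rewrite fE; have [] := bP x.
  split=> [|x y Kx Ky|a x Kx].
  - by rewrite linear0 subr0; apply: submod0 sK.
  - by rewrite linearD opprD addrACA; apply: submodD sK Kx Ky.
  - by rewrite linearZ -scalerBr; apply: (submodZ a sK Kx).
have [|e [eN eK eE]] := lift_idempotent sN sK fN fK.
  move=> c; apply: NKJ => //; first by apply: submodB.
have [S SE] : exists S : submodClosed F, forall c, (c \in S) = (e c == c).
  have [|S SE] := @submod_closed_of A F (fun c => e c = c).
    by split=> [|x y ex ey|a x ex]; rewrite ?linear0 ?linearD ?linearZ /= ?ex ?ey.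
  by exists S => c; rewrite SE; apply/asboolP/eqP.
have Se c : e c \in S by rewrite SE eE.
have eS (x : submod_type S) : e (\val x) = \val x.
  by apply/eqP; rewrite -SE; apply: valP.
have [|inj injE] := @linear_of A (submod_type S) F (fun x => \val x); first by [].
have [|pr prE] := @linear_of A F (submod_type S) (fun c => Sub (e c) (Se c)).
  move=> a x y; apply: val_inj; rewrite SubK linearP.
  by rewrite -[RHS]/(a *: e x + e y).
have inj_pr c : inj (pr c) = e c by rewrite prE injE SubK.
have pr_inj x : pr (inj x) = x.
  by apply: val_inj; rewrite -!injE inj_pr injE eS.
exists (submod_type S); exists (q \o inj : {linear _ -> _}); split.
- move=> M1 M2 p h psurj.
  have /choice[w wP] (x : M) : exists y, p y = h (pr << x >>) by apply: psurj.
  have [W WE] := free_lift w.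
  exists (W \o inj : {linear _ -> _}) => x /=.
  rewrite -[in RHS](pr_inj x); move: (inj x).
  apply: (@free_linear_eq A M M2 (p \o W) (h \o pr)) => y /=.
  by rewrite WE wP.
- move=> x; exists (pr << x >>); rewrite /= inj_pr.
  by have := eK << x >>; rewrite /K linearB /= qE => /eqP; rewrite subr_eq0 => /eqP.
- move=> L LK; apply: (nilpotent_superfluous (n := n)) (submod_in L) _.
    exact: nilpotent_ideal_pow rJ nilJ.
  move=> x; have [y [z [Ly /eqP Kz ->]]] := LK x; exists y => //; exists z => //.
  have : ideal_pow J 1 (inj z) by apply: NKJ => //; rewrite injE -eS.
  suff prJ c : ideal_pow J 1 c -> ideal_pow J 1 (pr c) by move=> /prJ; rewrite pr_inj.
  move=> Jc.
  apply: (Jc (fun c => ideal_pow J 1 (pr c))) => [|a d Ja _].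
    have sJ := @submod_ideal_pow A J (submod_type S) 1.
    split=> [|u v Ju Jv|a u Ju]; rewrite ?linear0 ?linearD ?linearZ.
    + exact: submod0 sJ.
    + exact: submodD sJ Ju Jv.
    + exact: (submodZ a sJ Ju).
  by rewrite linearZ; apply: mem_ideal_mul.
Qed.

End ProjectiveCovers.

Lemma converse_prod (R : pzRingType) (s : seq R) :
  \prod_(a <- (s : seq R^c)) a = \prod_(a <- rev s) a :> R.
Proof.
elim: s => [|a s IHs]; first by rewrite !big_nil.
rewrite big_cons rev_cons big_rcons -[LHS]/((\prod_(b <- (s : seq R^c)) b : R) * a).
by rewrite IHs.
Qed.

Lemma quasi_frobenius_perfect (R : nzRingType) : quasi_frobenius R -> perfect_ring R.
Proof.
move=> /quasi_frobenius_lacc_rself_inj[acc injR].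
have [k L1] := lacc_loewy injR acc.
have nilJ (s : seq R) : size s = k -> (forall a, a \in s -> a \in @jacobson R) ->
    \prod_(a <- s) a = 0.
  by move=> sk /allP sJ; rewrite -[LHS]mulr1; apply: L1.
have lJ := lideal_jacobson R; have rJ := rideal_jacobson R.
split=> M.
  apply: (@semiprimary_projective_cover R (fun x => x \in @jacobson R) k) => // P lP.
  exact: (lideal_idem injR (or_introl acc) lP).
apply: (@semiprimary_projective_cover R^c (fun x : R => x \in @jacobson R) k) => // [s sk sJ|P rP].
  rewrite converse_prod; apply: nilJ; rewrite ?size_rev // => a.
  by rewrite mem_rev; apply: sJ.
exact: (rideal_idem injR (or_introl acc) rP).
Qed.

(** * Commutative perfect rings *)

Section CommutativePerfect.
Variable A : nzRingType.
Hypothesis mulC : commutative (@GRing.mul A).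
Hypothesis perfA : forall M : lmodType A,
  exists (P : lmodType A) (p : {linear P -> M}), projective_cover p.

Definition jac (x : A) : Prop := forall m, lmax m -> m x.

Lemma lideal_jac : lideal jac.
Proof.
split=> [m [lm _ _]|x y Jx Jy m mm|a x Jx m mm]; first exact: lideal0.
  by have [lm _ _] := mm; apply: lidealD => //; [apply: Jx|apply: Jy].
by have [lm _ _] := mm; apply: lidealM => //; apply: Jx.
Qed.

Lemma lideal_comm (P : A -> Prop) : lideal P -> rideal P.
Proof. by move=> [P0 PD PM]; split=> // a x Px; rewrite mulC; apply: PM. Qed.

Lemma jac_unit a : jac a -> exists u, u * (1 - a) = 1.
Proof.
move=> Ja; apply: contrapT => nou.
have lP : lideal (fun x => exists u, x = u * (1 - a)).
  split; first by exists 0; rewrite mul0r.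
    by move=> _ _ [u ->] [v ->]; exists (u + v); rewrite mulrDl.
  by move=> b _ [u ->]; exists (b * u); rewrite mulrA.
have [[u e]|m mm Pm] := lmax_exists lP; first by apply: nou; exists u.
have [lm m1 _] := mm; apply: m1; rewrite -(subrK a 1); apply: lidealD => //.
  by apply: Pm; exists 1; rewrite mul1r.
exact: Ja.
Qed.

(** The projective cover of A/m is a direct factor eA of A in which em is
   superfluous. *)
Lemma local_idempotent m : lmax m ->
  exists e, [/\ e * e = e, ~ m e & forall x, m x -> jac (x * e)].
Proof.
move=> mm; have [I mI IE] := lmax_maximal_submod mm; have [lm m1 _] := mm.
have [P [p [projP psurj psup]]] := perfA (quotm I).
have [h hE] := projective_regular (quotm_pi I : {linear A^o -> _}) psurj.
have hZ (a : A) : h a = a *: h (1 : A).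
  by rewrite -{1}[a]mulr1; exact: (linearZZ h a (1 : A^o)).
have piE (a : A^o) : quotm_pi I a = 0 <-> m a.
  rewrite -(linear0 (@quotm_pi A A^o I)); split=> [/eqP|ma]; last first.
    by apply/eqP; rewrite quotm_piE subr0 IE; apply/asboolP.
  by rewrite quotm_piE subr0 IE => /asboolP.
have image (n : A -> Prop) : lideal n ->
    (forall a : A, exists2 b, n b & m (a - b)) -> forall y, exists2 b, n b & y = h b.
  move=> ln nm; have sK : submodule (fun y => exists2 b, n b & y = h b).
    split; first by exists 0; rewrite ?linear0 //; apply: lideal0.
      by move=> _ _ [a na ->] [b nb ->]; exists (a + b); [apply: lidealD|rewrite linearD].
    move=> r _ [a na ->]; exists (r * a); first exact: lidealM.
    by rewrite -linearZZ.
  have [K KE] := submod_closed_of sK.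
  move=> y; suff : y \in K by rewrite KE => /asboolP.
  apply: psup => {}y; have [a pya] := quotm_pi_surj (p y).
  have [b nb mab] := nm a; exists (h b), (y - h b); split; last by rewrite addrC subrK.
    by rewrite KE; apply/asboolP; exists b.
  rewrite inE linearB /= hE -pya -linearB; apply/eqP.
  exact/piE.
have hsurj : surjective_map h.
  move=> y; have [||b _ ->] := image (fun=> True) _ _ y; last by exists b.
    by split.
  by move=> a; exists a => //; rewrite subrr; apply: lideal0.
have [s sE] := projP _ _ h (idfun : {linear P -> P}) hsurj.
have shE (a : A) : s (h a) = a * (s (h (1 : A)) : A) by rewrite hZ linearZZ.
pose e : A := s (h (1 : A)).
have he : h e = h (1 : A) by rewrite sE.
have ee : e * e = e by rewrite -shE he.
exists e; split=> // [me|x mx m2 mm2].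
  by apply: m1; apply/piE; rewrite -hE -he hE; apply/piE.
have [lm2 m21 mm2'] := mm2; apply: contrapT => /mm2'[n [r [m2n e1]]].
have [a|y m2y h1] := image m2 lm2 _ (h (1 : A)).
  exists (a * n); first exact: lidealM.
  rewrite -[a in a - _]mulr1 -mulrBr e1 addrC addKr.
  apply: lidealM => //; apply: lidealM => //.
  by rewrite mulC; apply: lidealM.
suff m2e : m2 e by apply: m21; rewrite e1; apply: lidealD => //;
  apply: (lidealM r lm2); apply: (lidealM x lm2).
by rewrite /e h1 shE mulC; apply: lidealM.
Qed.

(** Let P be a projective module with P = JP, with section s : P -> F to a free
   module. All coordinates of s(y) are in J, so the coordinates c_w of s(x) satisfy
   c_w = sum_z c_z s(z)_w and generate an ideal N with N = JN. *)
Lemma projective_nakayama (P : lmodType A) : projective_module P ->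
  (forall x : P, ideal_pow jac 1 x) -> forall x : P, x = 0.
Proof.
move=> projP JP x; have [q qE] := @free_lift A P P id.
have [|s sE] := projP _ _ q (idfun : {linear P -> P}).
  by move=> y; exists << y >>; rewrite qE.
have coeffJ y z : jac (coeff z (s y)).
  apply: (JP y (fun y => jac (coeff z (s y)))) => [|a u Ja _].
    split=> [|u v Ju Jv|a u Ju].
    - by rewrite linear0 coeff0; apply: lideal0 lideal_jac.
    - by rewrite linearD coeffD; apply: lidealD lideal_jac Ju Jv.
    - by rewrite linearZ coeffZ; apply: (lidealM a lideal_jac Ju).
  by rewrite linearZ coeffZ mulC; apply: (lidealM _ lideal_jac Ja).
pose c := s x; pose cs : seq A^o := [seq coeff z c | z <- dom c].
have cE w : coeff w c = \sum_(z <- dom c) coeff w (s z) * coeff z c.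
  rewrite {1}/c -[x in LHS]sE -/c -{1}[c]freeg_sumE !linear_sum /=.
  rewrite (raddf_sum (coeff w)); apply: eq_bigr => z _.
  have -> : << coeff z c *g z >> = coeff z c *: << z >> :> {freeg P / A}.
    by apply/eqP/freeg_eqP=> y; rewrite coeffZ !coeffU mul1r.
  by rewrite !linearZ /= qE coeffZ mulC.
have csJ u : spans cs u -> ideal_mul jac (spans cs) u.
  apply: spans_sub; first exact: submod_ideal_mul.
  move=> _ /mapP[w _ ->]; rewrite cE big_seq.
  have sJ := @submod_ideal_mul A A^o jac (spans cs).
  elim/big_ind: _ => [|u1 u2|z zc]; [exact: submod0 sJ|exact: submodD sJ|].
  apply: (@mem_ideal_mul A A^o jac); first exact: coeffJ.
  by apply: mem_spans; apply: map_f.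
have c0 : c = 0.
  apply/eqP/freeg_eqP=> z; rewrite coeff0.
  have [zc|/coeff_outdom//] := boolP (z \in dom c).
  apply: (@nakayama A A^o jac cs) => //; first exact: lideal_jac.
  - exact: lideal_comm lideal_jac.
  - exact: jac_unit.
  - by apply: mem_spans; apply: map_f.
by rewrite -[x]sE -/c c0 linear0.
Qed.

(** If M = JM has projective cover P -> M, then P = JP + ker, hence P = JP because the
   kernel is superfluous. *)
Lemma perfect_nakayama (M : lmodType A) :
  (forall x : M, ideal_pow jac 1 x) -> forall x : M, x = 0.
Proof.
move=> JM x; have [P [p [projP psurj psup]]] := perfA M.
have sJ := @submod_ideal_pow A jac P 1; have [K KE] := submod_closed_of sJ.
have JP (y : P) : ideal_pow jac 1 y.
  suff : y \in K by rewrite KE => /asboolP.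
  apply: psup => {}y.
  have [|a u Ja _|z Jz pzy] :=
      JM (p y) (fun u => exists2 z, ideal_pow jac 1 z & p z = u).
  - split; first by exists 0; [apply: submod0 sJ|rewrite linear0].
      move=> _ _ [u Ju <-] [v Jv <-]; exists (u + v); last by rewrite linearD.
      exact: submodD sJ Ju Jv.
    move=> a _ [u Ju <-]; exists (a *: u); last by rewrite linearZ.
    exact: (submodZ a sJ Ju).
  - have [v <-] := psurj u; exists (a *: v); last by rewrite linearZ.
    exact: mem_ideal_mul.
  exists z, (y - z); split; last by rewrite addrC subrK.
    by rewrite KE; apply/asboolP.
  by rewrite inE linearB /= pzy subrr.
by have [y <-] := psurj x; rewrite (projective_nakayama projP JP y) linear0.
Qed.

(** The direct limit of A -a0-> A -a1-> A ... equals J times itself, hence vanishes.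
   It is presented as the free module on nat modulo the elements killed by almost all
   of the maps phi_N sending the i-th generator to a_i ... a_(N-1). *)
Lemma jac_tnilpotent (a : nat -> A) : (forall i, jac (a i)) ->
  exists n, \prod_(0 <= i < n) a i = 0.
Proof.
move=> Ja; have /choice[phi phiE] N : exists phi : {linear {freeg nat / A} -> A^o},
    forall i, phi << i >> = (if (i <= N)%N then \prod_(i <= j < N) a j else 0).
  exact: free_lift.
have sL : submodule (fun c => exists k, forall N, (k <= N)%N -> phi N c = 0).
  split; first by exists 0%N => N _; rewrite linear0.
    move=> x y [k kx] [l ly]; exists (maxn k l) => N; rewrite geq_max => /andP[kN lN].
    by rewrite linearD kx ?ly ?addr0.
  by move=> r x [k kx]; exists k => N kN; rewrite linearZ /= kx ?scaler0.
have [L LE] := submod_closed_of sL.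
have piE c : quotm_pi L c = 0 <-> exists k, forall N, (k <= N)%N -> phi N c = 0.
  rewrite -(linear0 (@quotm_pi A _ L)); split=> [/eqP|Lc]; last first.
    by apply/eqP; rewrite quotm_piE subr0 LE; apply/asboolP.
  by rewrite quotm_piE subr0 LE => /asboolP.
have [k] : exists k, forall N, (k <= N)%N -> phi N << 0%N >> = 0.
  apply/piE; apply: perfect_nakayama => u; have [c <-] := quotm_pi_surj u.
  have sJ := @submod_ideal_pow A jac (quotm L) 1.
  apply: (@free_ind A nat (fun c => ideal_pow jac 1 (quotm_pi L c))) c => [|i].
    split=> [|x y Jx Jy|r x Jx]; rewrite ?linear0 ?linearD ?linearZ.
    - exact: submod0 sJ.
    - exact: submodD sJ Jx Jy.
    - exact: (submodZ r sJ Jx).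
  have -> : quotm_pi L << i >> = a i *: quotm_pi L << i.+1 >>.
    apply/eqP; rewrite -linearZ -subr_eq0 -linearB; apply/eqP/piE.
    exists i.+1 => N iN; rewrite linearB linearZ /= !phiE iN (ltnW iN).
    by rewrite big_ltn // subrr.
  exact: mem_ideal_mul.
by move=> /(_ k (leqnn k)); rewrite phiE; exists k.
Qed.

(** T-nilpotence as it is applied: factors from J cannot be appended forever while
   keeping the product nonzero. *)
Lemma jac_sequence (X : Type) (b : X -> A) (x0 : X) :
  b x0 = 1 -> (forall x, b x != 0) ->
  ~ (forall x, exists y a, jac a /\ b y = b x * a).
Proof.
move=> b0 bn step; have [f f0 fS] := dependent_choice x0 step.
have [a aP] := choice fS; have [n an] := @jac_tnilpotent a (fun i => (aP i).1).
have bE k : b (f k) = \prod_(0 <= i < k) a i.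
  elim: k => [|k IHk]; first by rewrite f0 b0 big_geq.
  by rewrite (aP k).2 IHk big_nat_recr.
by have := bn (f n); rewrite bE an eqxx.
Qed.

(** If x in I were outside G, then peeling factors off from I <= G + JI would give
   a_1, a_2, ... in J and y_n in I with a_1 ... a_n y_n outside G for all n. *)
Lemma tnilpotent_nakayama (M : lmodType A) (G I : M -> Prop) : submodule G ->
  (forall x, I x -> sum_submod G (ideal_mul jac I) x) -> forall x, I x -> G x.
Proof.
move=> sG GJ x Ix; apply: contrapT => Gx.
pose X := {p : A * M | I p.2 /\ ~ G (p.1 *: p.2)}.
have x0P : I (1 : A, x).2 /\ ~ G ((1 : A, x).1 *: (1 : A, x).2) by rewrite /= scale1r.
apply: (@jac_sequence X (fun p => (sval p).1) (exist _ (1, x) x0P)) => //.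
  move=> [[b y] /= [Iy Gby]]; apply/eqP=> b0; apply: Gby; rewrite b0 scale0r.
  exact: submod0.
move=> [[b y] /= [Iy Gby]]; have [g Gg [w Jw yE]] := GJ y Iy.
have [a [z [Ja Iz Gz]]] : exists a z, [/\ jac a, I z & ~ G ((b * a) *: z)].
  apply: contrapT => noz; apply: Gby; rewrite yE scalerDr; apply: submodD => //.
    exact: submodZ.
  apply: (Jw (fun w => G (b *: w))) => [|a z Ja Iz].
    split=> [|u v Gu Gv|r u Gu]; first by rewrite scaler0; apply: submod0.
      by rewrite scalerDr; apply: submodD.
    by rewrite scalerA mulC -scalerA; apply: submodZ.
  by rewrite scalerA; apply: contrapT => Gz; apply: noz; exists a, z.
by exists (exist _ (b * a, z) (conj Iz Gz)), a.
Qed.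
End CommutativePerfect.

Section CommutativePerfectInjective.
Variable A : nzRingType.
Hypothesis mulC : commutative (@GRing.mul A).
Hypothesis perfA : forall M : lmodType A,
  exists (P : lmodType A) (p : {linear P -> M}), projective_cover p.

(** With e the local idempotent of m, eE is not inside JE; a submodule K maximal
   among those containing { y | ey in JE } and avoiding some y0 is the kernel of a
   map onto A/m that sends y0 to 1. *)
Lemma perfect_simple_quotient (E : lmodType A) (i : {linear A^o -> E})
    (I : submodClosed A^o) : injective i -> maximal_submod I ->
  exists (f : {linear E -> quotm I}) e, f e != 0.
Proof.
move=> i_inj /maximal_submod_lmax; set m := (fun x => _); move=> mm.
have [lm m1 mmax] := mm; have [e [ee me mJ]] := local_idempotent mulC perfA mm.
have sJ := @submod_ideal_pow A (@jac A) E 1.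
have ZC (a b : A) (y : E) : a *: (b *: y) = b *: (a *: y) by rewrite !scalerA mulC.
have sN0 : submodule (fun y : E => ideal_pow (@jac A) 1 (e *: y)).
  split=> [|y z Ny Nz|a y Ny]; first by rewrite scaler0; apply: submod0 sJ.
    by rewrite scalerDr; apply: submodD sJ Ny Nz.
  by rewrite ZC; apply: (submodZ a sJ Ny).
have mN0 x (y : E) : m x -> ideal_pow (@jac A) 1 (e *: (x *: y)).
  by move=> mx; rewrite ZC scalerA; apply: mem_ideal_mul => //; apply: mJ.
have [y0 Ny0] : exists y0 : E, ~ ideal_pow (@jac A) 1 (e *: y0).
  apply: contrapT => /forallNP allN; apply: me.
  have sG : submodule (fun y : E => e *: y = 0).
    split=> [|y z ey ez|a y ey]; first by rewrite scaler0.
      by rewrite scalerDr ey ez addr0.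
    by rewrite ZC ey scaler0.
  suff e0 : e = 0 by rewrite e0; apply: lideal0 lm.
  apply: i_inj; rewrite linear0 -{1}[e]mulr1.
  rewrite [LHS](linearZZ i e (1 : A^o)).
  apply: (@tnilpotent_nakayama A mulC perfA E _ (fun=> True) sG) => // y _.
  exists (y - e *: y); first by rewrite scalerBr scalerA ee subrr.
  by exists (e *: y); [apply: contrapT; apply: allN|rewrite subrK].
have [|K [sK NK badK maxK]] := zorn_avoid (bad := fun z => z = y0) sN0.
  by move=> x Nx xy0; apply: Ny0; rewrite -xy0.
have Ky0 : ~ K y0 by move=> /badK.
have mK x (y : E) : m x -> K (x *: y) by move=> mx; apply: NK; apply: mN0.
have ry0 (r : A) : K (r *: y0) -> m r.
  move=> Kr; apply: contrapT => /mmax[n [t [mn e1]]]; apply: Ky0.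
  rewrite -[y0]scale1r e1 scalerDl -scalerA; apply: submodD => //; first exact: mK.
  exact: submodZ.
have /choice[r rP] (y : E) : exists r : A, K (y - r *: y0).
  have [Ky|/maxK[n [a [Kn y0E]]]] := pselect (K y); first by exists 0; rewrite scale0r subr0.
  have [ma|/mmax[u [t [mu e1]]]] := pselect (m a).
    by case: Ky0; rewrite -y0E; apply: submodD => //; apply: mK.
  exists t; rewrite -y0E scalerDr scalerA -{1}[y]scale1r e1 scalerDl.
  rewrite [t *: n + _]addrC opprD addrA addrK; apply: submodB => //; first exact: mK.
  exact: submodZ.
have piE (a b : A^o) : quotm_pi I a = quotm_pi I b <-> m (a - b).
  by split=> [/eqP|mab]; [|apply/eqP]; rewrite quotm_piE.
have [|f fE] := @linear_of A E (quotm I) (fun y => quotm_pi I (r y : A^o)).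
  move=> a y z; rewrite -linearP; apply/piE/ry0.
  rewrite scalerBl; set u := a *: y + z.
  have -> : r u *: y0 - (a *: (r y : A^o) + r z) *: y0 =
      (a *: (y - r y *: y0) + (z - r z *: y0)) - (u - r u *: y0).
    rewrite scalerDl scalerBr scalerA [in RHS]addrACA -[in RHS]opprD -/u opprB.
    by rewrite [RHS]addrC addrA subrK.
  by apply: submodB => //; apply: submodD => //; apply: submodZ.
exists f, y0; rewrite fE; apply/eqP; rewrite -(linear0 (@quotm_pi A _ I)) => /piE.
rewrite subr0 => mr; apply: Ky0; rewrite -(subrK (r y0 *: y0) y0).
by apply: submodD => //; apply: mK.
Qed.

Lemma perfect_max_projective_lself_inj (E : lmodType A) (i : {linear A^o -> E}) :
  injective i -> injective_module E -> max_projective_module E -> @lself_inj A.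
Proof.
move=> i_inj injE projE; apply: (max_projective_lself_inj injE projE) => I mI.
exact: perfect_simple_quotient i_inj mI.
Qed.

(** By T-nilpotence some eb <> 0 is killed by J, and m(eb) = (me)(eb) with me <= J. *)
Lemma perfect_kasch (m : A -> Prop) : lmax m ->
  exists2 y : A, y != 0 & forall r, m r -> r * y = 0.
Proof.
move=> mm; have [lm m1 _] := mm.
have [e [ee me mJ]] := local_idempotent mulC perfA mm.
have [b eb0 bJ] : exists2 b : A, e * b != 0 & forall a : A, jac a -> e * b * a = 0.
  apply: contrapT => nob; pose X := {b : A | e * b != 0}.
  have e1 : e * 1 != 0.
    by rewrite mulr1; apply: contra_notN me => /eqP->; apply: lideal0 lm.
  apply: (@jac_sequence A mulC perfA X sval (exist _ 1 e1)) => // [[b eb] /=|[b eb]].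
    by apply: contraNneq eb => ->; rewrite mulr0.
  apply: contrapT => noa; apply: nob; exists b => // a Ja.
  apply: contrapT => /eqP; rewrite -mulrA => eba; apply: noa.
  by exists (exist _ (b * a) eba), a.
exists (e * b) => // r mr.
by rewrite -ee -mulrA [r * _]mulrA mulC; apply: bJ; apply: mJ.
Qed.

End CommutativePerfectInjective.

(** * Linear compactness and finite generation of ideals *)

Section CommutativePerfectNoetherian.
Variable A : nzRingType.
Hypothesis mulC : commutative (@GRing.mul A).
Hypothesis perfA : forall M : lmodType A,
  exists (P : lmodType A) (p : {linear P -> M}), projective_cover p.
Hypothesis injA : @lself_inj A.

(** Commutativity lets the separation lemma for right ideals be read in the converse
   ring, where the Kasch property is perfect_kasch. *)
Lemma perfect_lideal_separate (I : A -> Prop) x : lideal I -> ~ I x ->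
  exists2 c, forall a, I a -> a * c = 0 & x * c != 0.
Proof. exact: (@rideal_separate A^c I x injA (perfect_kasch mulC perfA)). Qed.

Section Tower.
Variables (L : A -> Prop) (x : nat -> A).
Hypothesis lL : @lideal A L.

(** L + Ax_p + ... + Ax_(p+k-1); the initial segments have p = 0, and the tails W_n
   are unions of towers with p = n. *)
Fixpoint tower p k : A -> Prop :=
  if k is k'.+1 then ladj (tower p k') (x (p + k')%N) else L.

Lemma lideal_tower p k : lideal (tower p k).
Proof. by elim: k => // k; apply: lideal_ladj. Qed.

Lemma tower_addr p k l y : tower p k y -> tower p (k + l) y.
Proof. by move=> ty; elim: l => [|l IHl]; rewrite ?addn0 // addnS; apply: ladj_sub. Qed.

Lemma tower_shift p q k y : tower (p + q) k y -> tower p (q + k) y.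
Proof.
elim: k y => [|k IHk] y; first by rewrite addn0 => Ly; apply: (@tower_addr p 0 q).
rewrite addnS => -[z /IHk tz [a ->]]; exists z => //; exists a; rewrite addnA //.
Qed.

Lemma tower_mem p k : tower p k.+1 (x (p + k)%N).
Proof. exact/ladj_id/lideal_tower. Qed.

Lemma tower_le p k l y : (k <= l)%N -> tower p k y -> tower p l y.
Proof. by move=> /subnKC <-; apply: tower_addr. Qed.

Definition tail n y : Prop := exists k, tower n k y.

Lemma lideal_tail n : lideal (tail n).
Proof.
split=> [|y z [k ky] [l lz]|a y [k ky]]; first by exists 0%N; apply: lideal0 lL.
  exists (maxn k l); apply: lidealD (lideal_tower _ _) _ _.
    exact: tower_le (leq_maxl k l) ky.
  exact: tower_le (leq_maxr k l) lz.
by exists k; apply: (lidealM a (lideal_tower _ _) ky).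
Qed.

Lemma tail_addr n k y : tail (n + k) y -> tail n y.
Proof. by move=> [l /tower_shift ly]; exists (k + l)%N. Qed.

Lemma tail_mem n k : tail n (x (n + k)%N).
Proof. by exists k.+1; apply: tower_mem. Qed.

(** Linear compactness: with W_n the tails and s_n = x_0 + ... + x_(n-1), multiplication
   by s_n on ann(W_n) defines one map on the union of the ann(W_n), because x_i kills
   ann(W_n) for i >= n; it is multiplication by some c, and c - s_n kills ann(W_n). *)
Lemma tail_limit : exists c, forall n, tail n (c - \sum_(0 <= i < n) x i).
Proof.
pose s n := \sum_(0 <= i < n) x i.
pose B n b := forall y, tail n y -> y * b = 0.
have BS n k b : B n b -> B (n + k)%N b by move=> Bb y /tail_addr; apply: Bb.
have sB n k b : B n b -> s (n + k)%N * b = s n * b.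
  move=> Bb; elim: k => [|k IHk]; first by rewrite addn0.
  rewrite addnS /s big_nat_recr //= mulrDl -/(s _) IHk.
  by rewrite (Bb _ (tail_mem n k)) addr0.
have [||||c cP] := @lself_inj_graph A (fun b v => exists2 n, B n b & v = s n * b) injA.
- by exists 0%N => [y _|]; rewrite mulr0.
- move=> b b' v v' [n Bb ->] [n' Bb' ->]; have Bn'b' := BS n' n b' Bb'.
  rewrite addnC in Bn'b'; exists (n + n')%N.
    by move=> y ty; rewrite mulrDr (BS n n' b Bb) // Bn'b' // addr0.
  by rewrite mulrDr sB // [(n + n')%N]addnC sB.
- move=> r b v [n Bb ->]; exists n => [y ty|]; last by rewrite !mulrA [r * _]mulC.
  by rewrite mulrA [y * r]mulC -mulrA Bb // mulr0.
- by move=> v [n _ ->]; rewrite mulr0.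
exists c => n; apply: contrapT => nt.
have [z zt] := perfect_lideal_separate (lideal_tail n) nt; case/eqP.
by rewrite mulrBl [c * z]mulC -(cP z (s n * z)) ?subrr //; exists n.
Qed.

End Tower.

(** Suppose I is not finitely generated and let L = JI. By Nakayama no finitely
   generated F satisfies F + L = I, so one finds x_n in I outside
   L + Ax_0 + ... + Ax_(n-1) with m_n x_n inside L for a maximal ideal m_n; these are
   independent modulo L. The limit c of their partial sums lies in
   L + Ax_0 + ... + Ax_(k-1) for some k, but its x_k-coordinate should be 1. *)
Lemma perfect_lideal_spans (I : A -> Prop) : @lideal A I ->
  exists2 s : seq A^o, (forall x, x \in s -> I x) & forall x, I x -> spans s x.
Proof.
move=> lI; apply: contrapT => nofg.
pose L : A -> Prop := @ideal_mul A A^o (@jac A) I.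
have lL : @lideal A L := @submod_ideal_mul A A^o (@jac A) I.
pose next (s : seq A^o) (x : A) (m : A -> Prop) :=
  [/\ I x, ~ @sum_submod A A^o (spans s) L x, lmax m & forall r, m r -> L (r * x)].
have nextP (s : seq A^o) : (forall x, x \in s -> I x) -> exists x m, next s x m.
  move=> sI; have sF := @submod_add A A^o _ _ (submod_spans s) lL.
  have [x Ix Fx] : exists2 x, I x & ~ @sum_submod A A^o (spans s) L x.
    apply: contrapT => nox; apply: nofg; exists s => //.
    apply: (@tnilpotent_nakayama A mulC perfA A^o _ I (submod_spans s)) => y Iy.
    by apply: contrapT => Fy; apply: nox; exists y.
  have lC : @lideal A (fun r => @sum_submod A A^o (spans s) L (r * x)).
    split=> [|a b Ca Cb|a b Cb]; first by rewrite mul0r; apply: submod0 sF.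
      by rewrite mulrDl; apply: submodD sF Ca Cb.
    by rewrite -mulrA; apply: (submodZ a sF Cb).
  have [|m mm Cm] := lmax_exists lC; first by rewrite mul1r.
  have [e [_ me mJ]] := local_idempotent mulC perfA mm.
  exists (e * x), m; split=> //; first exact: lidealM.
    by move=> /Cm.
  move=> r mr; rewrite mulrA.
  exact: (@mem_ideal_mul A A^o (@jac A) I _ x (mJ r mr) Ix).
have nilI : forall x, x \in ([::] : seq A^o) -> I x by [].
have [[s sI]|f f0 fS] := @dependent_choice {s : seq A^o | forall x, x \in s -> I x}
    (exist _ [::] nilI)
    (fun s s' => exists x m, next (sval s) x m /\ sval s' = x :: sval s).
  have [x [m nx]] := nextP s sI; have [Ix _ _ _] := nx.
  have xsI : forall y, y \in (x :: s : seq A^o) -> I y.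
    by move=> y; rewrite inE => /predU1P[->|/sI].
  by exists (exist _ (x :: s) xsI); exists x, m.
have [x xP] := choice fS; have [m mP] := choice xP.
have lT := lideal_tower x lL.
have Tf n y : tower L x 0 n y -> @sum_submod A A^o (spans (sval (f n))) L y.
  elim: n y => [|n IHn] y /=.
    by move=> Ly; apply: sum_submodr Ly; apply: submod_spans.
  have [_ ->] := mP n; have sF := @submod_add A A^o _ _ (submod_spans (x n :: sval (f n) : seq A^o)) lL.
  move=> [z /IHn[u su [l Ll ->]] [a ->]]; apply: (submodD sF).
    exists u; last by exists l.
    exact: sum_submodl (submod_cyclic _) su.
  apply: (submodZ a sF); apply: sum_submodl => //.
  by apply: mem_spans; rewrite inE eqxx.
have xT n : ~ tower L x 0 n (x n).
  by move=> /Tf; have [[_ + _ _] _] := mP n.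
have mL n r : m n r -> L (r * x n) by have [[_ _ _ +] _] := mP n; apply.
have indep n k y : tower L x 0 n y -> ~ tower L x n.+1 k (x n - y).
  elim: k y => [|k IHk] y ty.
    move=> Ly; apply: (xT n); rewrite -(subrK y (x n)).
    by apply: (lidealD (lT 0%N n)) ty; apply: (@tower_addr L x 0 0 n).
  move=> [w tw [d xE]]; have [_ _ mmax] : lmax (m (n.+1 + k)%N).
    by have [[_ _ + _] _] := mP (n.+1 + k)%N.
  have [md|/mmax[u [t [mu e1]]]] := pselect (m (n.+1 + k)%N d).
    apply: (IHk (y + d * x (n.+1 + k)%N)); last by rewrite opprD addrA xE addrK.
    by apply: (lidealD (lT 0%N n)) => //; apply: (@tower_addr L x 0 0 n); apply: mL.
  apply: (xT (n.+1 + k)%N); rewrite -[X in tower _ _ _ _ X]mul1r e1 mulrDl.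
  apply: (lidealD (lT 0%N (n.+1 + k)%N)).
    by apply: (@tower_addr L x 0 0 (n.+1 + k)); apply: mL.
  have -> : t * d * x (n.+1 + k)%N = t * (x n - y - w).
    by rewrite xE addrC addKr mulrA.
  have tle z j : (j <= n.+1 + k)%N -> tower L x 0 j z -> tower L x 0 (n.+1 + k) z.
    exact: tower_le.
  apply: (lidealM t (lT 0%N (n.+1 + k)%N)); apply: (lidealB (lT _ _)).
    apply: (lidealB (lT _ _)); first by apply: (tle _ n.+1); rewrite ?leq_addr //; apply: tower_mem.
    by apply: tle ty; rewrite addSnnS leq_addr.
  exact: (@tower_shift L x 0 n.+1 k).
have [c cP] := tail_limit x lL.
have [k ck] := cP 0%N; rewrite big_geq // subr0 in ck.
have [l lP] := cP k.+1.
apply: (@indep k l (c - \sum_(0 <= i < k) x i)).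
  apply: (lidealB (lT _ _)) => //.
  elim: (k) => [|q IHq]; first by rewrite big_geq //; apply: lideal0.
  by rewrite big_nat_recr //=; exists (\sum_(0 <= i < q) x i) => //; exists 1; rewrite mul1r.
have -> : x k - (c - \sum_(0 <= i < k) x i) = - (c - \sum_(0 <= i < k.+1) x i).
  by rewrite !opprB big_nat_recr //= addrA [x k + _]addrC.
exact: (lidealN (lT _ _)).
Qed.
End CommutativePerfectNoetherian.

(** * The equivalences *)

Lemma spans_noetherian_module (A : pzRingType) :
  (forall I : A -> Prop, lideal I -> exists2 s : seq A^o,
    (forall x, x \in s -> I x) & forall x, I x -> spans s x) ->
  noetherian_module A^o.
Proof.
move=> fg N NS.
have Nle n m x : (n <= m)%N -> x \in N n -> x \in N m.
  by move=> /subnK<- Nx; elim: (m - n)%N => // k; apply: NS.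
have lU : @lideal A (fun x => exists n, (x : A^o) \in N n).
  split=> [|x y [n nx] [m my]|a x [n nx]]; first by exists 0%N; apply: rpred0.
    exists (maxn n m); apply: (@rpredD _ (N (maxn n m)) x y).
      exact: Nle (leq_maxl n m) nx.
    exact: Nle (leq_maxr n m) my.
  by exists n; apply: (@rpredZ _ _ (N n) a x).
have [s sU Us] := fg _ lU.
have [n sn] : exists n, forall x, x \in s -> x \in N n.
  elim: s sU {Us} => [|x s IHs] sU; first by exists 0%N.
  have [|n sn] := IHs; first by move=> y ys; apply: sU; rewrite inE ys orbT.
  have [m xm] := sU x (mem_head x s); exists (maxn n m) => y.
  rewrite inE => /predU1P[->|/sn]; last exact/Nle/leq_maxl.
  exact: Nle (leq_maxr n m) xm.
exists n => m le_nm x; apply/idP/idP => [mx|]; last exact: Nle.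
apply: (@spans_sub A A^o (fun x => x \in N n) s) => //; first exact: submod_in.
by apply: Us; exists m.
Qed.

Lemma quasi_frobenius_right_self_injective (R : pzRingType) :
  quasi_frobenius R -> right_self_injective R.
Proof. by move=> /quasi_frobenius_lacc_rself_inj[_ /rself_inj_module]. Qed.

Lemma right_self_injective_hull (R : pzRingType) (P : rmodType R -> Prop) :
  right_self_injective R -> P R^c^o -> injective_hull_satisfies R^c^o P.
Proof.
move=> injR PR; exists R^c^o, (idfun : {linear R^c^o -> R^c^o}).
by split=> //; apply: injective_hull_self.
Qed.

Lemma commutative_perfect_quasi_frobenius (R : nzRingType) :
  commutative (@GRing.mul R) -> right_perfect R -> ER_max_projective R ->
  quasi_frobenius R.
Proof.
move=> mulC perfR [E [i [[injE i_inj _] projE]]].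
have mulC' : commutative (@GRing.mul R^c) by move=> x y; apply: mulC.
have injR := @perfect_max_projective_lself_inj R^c mulC' perfR E i i_inj injE projE.
split; right; last exact: (lself_inj_injective_module injR).
apply: (@spans_noetherian_module R^c).
exact: (@perfect_lideal_spans R^c mulC' perfR injR).
Qed.

Theorem corollary2p14 (R : nzRingType) :
  (quasi_frobenius R <->
    [/\ one_sided_noetherian R, right_dual_kasch R & ER_projective R]) /\
  (quasi_frobenius R <->
    [/\ one_sided_noetherian R, right_dual_kasch R, semilocal R
      & ER_max_projective R]) /\
  (commutative (@GRing.mul R) ->
    (quasi_frobenius R <-> perfect_ring R /\ ER_max_projective R)).
Proof.
have hull_max_proj : ER_projective R -> ER_max_projective R.
  move=> [E [i [hull projE]]]; exists E, i; split=> //.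
  exact: projective_max_projective.
have qf_proj : quasi_frobenius R -> ER_projective R.
  move=> /quasi_frobenius_right_self_injective/right_self_injective_hull; apply.
  exact: projective_regular.
have qf_kasch : quasi_frobenius R -> right_dual_kasch R.
  by move=> /quasi_frobenius_right_self_injective/rself_inj_dual_kasch.
have kasch_qf : one_sided_noetherian R -> right_dual_kasch R -> ER_max_projective R ->
    quasi_frobenius R.
  by move=> noeth kasch projE; split=> //; right; apply: dual_kasch_self_injective.
split; [|split=> [|mulC]]; split.
- by move=> qf; split; [exact: qf.1|exact: qf_kasch|exact: qf_proj].
- by move=> [noeth kasch /hull_max_proj]; apply: kasch_qf.
- move=> qf; split; [exact: qf.1|exact: qf_kasch| |exact/hull_max_proj/qf_proj].
  by have [acc injR] := quasi_frobenius_lacc_rself_inj qf; apply: rself_inj_semilocal.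
- by move=> [noeth kasch _]; apply: kasch_qf.
- move=> qf; split; first exact: quasi_frobenius_perfect.
  exact/hull_max_proj/qf_proj.
- by move=> [[_ perfR]]; apply: commutative_perfect_quasi_frobenius.
Qed.
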